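(* Let $p,q$ be coprime positive integers with $q$ odd, and let $E_{p,q}$ be the exterior of the $(p,q)$-torus knot. Then for every generic $c\in\mathbb{C}$ and every integer $g\ge 0$, $$\sum_{[\rho]\in \mathrm{tr}_\mu^{-1}(c)} \bigl(2\,\mathbb{T}_\mu(\rho)\bigr)^{g-1}\in\mathbb{Z},$$ where $\mathbb{T}_\mu(\rho)$ is the adjoint Reidemeister torsion of $E_{p,q}$ associated with the meridian $\mu$ and the sum is over the conjugacy classes of irreducible representations $\rho:\pi_1(E_{p,q})\to \mathrm{SL}_2(\mathbb{C})$ with $\mathrm{tr}\,\rho(\mu)=c$.
   Context: The knot group is $G_{p,q}=\pi_1(E_{p,q})=\langle\alpha,\beta\mid\alpha^p=\beta^q\rangle$, with meridian $\mu=\alpha^{-r}\beta^s$, where $r,s$ are integers with $ps-qr=1$. $X^{irr}(G_{p,q})$ denotes the set of characters of irreducible $\mathrm{SL}_2(\mathbb{C})$-representations, identified with the set of conjugacy classes $[\rho]$ of such representations, and $\mathrm{tr}_\mu([\rho])=\mathrm{tr}\,\rho(\mu)$; here $\mathrm{tr}_\mu^{-1}(c)$ is the level set in $X^{irr}(G_{p,q})$. Known structure: $X^{irr}(G_{p,q})$ is the disjoint union of $(p-1)(q-1)/2$ components $\mathbb{C}_{a,b}$, indexed by integers $0<a<p$, $0<b<q$, $a\equiv b\pmod 2$. On $\mathbb{C}_{a,b}$ one has $\mathrm{tr}\,\rho(\alpha)=2\cos(\pi a/p)$ and $\mathrm{tr}\,\rho(\beta)=2\cos(\pi b/q)$, and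 $\mathrm{tr}_\mu$ restricts to an isomorphism $\mathbb{C}_{a,b}\cong\mathbb{C}\setminus\{2\cos(ar\pi/p\pm bs\pi/q)\}$. ''Generic $c$'' means that $c$ is not one of these finitely many excluded values, so $\mathrm{tr}_\mu^{-1}(c)$ contains exactly one point in each $\mathbb{C}_{a,b}$, i.e. $(p-1)(q-1)/2$ points. Adjoint Reidemeister torsion: let $C_*=\mathfrak{sl}_2(\mathbb{C})\otimes_{\mathbb{Z}[G_{p,q}]}C_*(\widetilde{E}_{p,q};\mathbb{Z})$ be the chain complex twisted by $\mathrm{Ad}\circ\rho$, with basis $\mathbf{c}_i$ of $C_i$ induced by lifts of cells and a basis of $\mathfrak{sl}_2(\mathbb{C})$. For irreducible $\rho$, $H_0=0$ and $H_1,H_2$ are one-dimensional. Let $P\in\mathfrak{sl}_2(\mathbb{C})$ be a nonzero vector fixed by $\mathrm{Ad}\rho(\pi_1(\partial E_{p,q}))$; take as basis of $H_1$ the image of the class $[P\otimes\tilde\mu]$ and as basis of $H_2$ the image of the class $[P\otimes\widetilde{\partial E_{p,q}}]$. Then $\mathbb{T}_\mu(\rho)=\prod_i[\partial(\mathbf{b}_{i+1})\,\tilde{\mathbf{h}}_i\,\mathbf{b}_i/\mathbf{c}_i]^{(-1)^{i+1}}$ with the standard sign normalization, where $\mathbf{b}_i\subset C_i$ is such that $\partial \mathbf{b}_i$ is a basis of the image of $\partial: C_i\to C_{i-1}$, $\tilde{\mathbf{h}}_i$ is a lift of the chosen basis of $H_i$, and $[\,\cdot/\cdot\,]$ is the determinant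 of the change of basis. It depends only on the conjugacy class of $\rho$. It is a known fact that on $\mathbb{C}_{a,b}$ it has the constant value $$\mathbb{T}_\mu(\rho)=\frac{pq}{16\sin^2(\pi a/p)\sin^2(\pi b/q)}.$$ *)

(* Defs.v *)
From HB Require Import structures.
From mathcomp Require Import all_boot all_order all_algebra.
From mathcomp Require Import complex.
From mathcomp Require Import boolp classical_sets cardinality fsbigop reals trigo.
Set Implicit Arguments.
Unset Strict Implicit.
Unset Printing Implicit Defensive.
Import Order.TTheory GRing.Theory Num.Theory.

Local Open Scope ring_scope.
Local Open Scope complex_scope.
Local Open Scope classical_set_scope.

(* A word in alpha, beta and their inverses; the second component of a letter
   is true for an inverse. *)
Definition word := seq (bool * bool).
Definition alpha : bool := false.
Definition beta : bool := true.

Definition wpow (x : bool) (n : int) : word := nseq `|n|%N (x, n < 0).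

(* G_{p,q} = < alpha, beta | relator >; the relator is alpha^p beta^-q. *)
Definition relator (p q : nat) : word := wpow alpha p%:Z ++ wpow beta (- q%:Z).

Definition meridian (r s : int) : word := wpow alpha (- r) ++ wpow beta s.

(* The regular fibre h = alpha^p; the longitude is h mu^(-pq), so mu and h
   generate the peripheral subgroup pi_1 of the boundary torus. *)
Definition fibre (p : nat) : word := wpow alpha p%:Z.

(* Representatives sum n_i w_i of elements of the integral group ring. *)
Definition gring := seq (int * word).

(* Fox derivative, which is also the x-coordinate of the lift of a path w to
   the universal cover: d_x(l w) = d_x l + l d_x w. *)
Fixpoint fox (x : bool) (w : word) : gring :=
  if w is l :: w' then
    (if l.1 == x then
       [:: if l.2 then (-1, [:: (x, true)]) else (1, [::])]
     else [::])
    ++ [seq (t.1, l :: t.2) | t <- fox x w']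
  else [::].

Definition aug (z : gring) : int := \sum_(t <- z) t.1.

(* The torsion of a based complex C_2 -d2-> C_1 -d1-> C_0, acting on row
   vectors in the given bases, where m_i is the rank of d_i, k_i = dim H_i, and
   the rows of h_i are cycles representing the chosen basis of H_i. The rows of
   b_i form the family with d_i(b_i) a basis of the image of d_i. As in Turaev's
   sign-refined torsion, the product carries the sign (-1)^|C| with
   |C| = sum_i (sum_(j <= i) dim C_j) (sum_(j <= i) dim H_j). *)
Definition torsion_sign (m1 m2 k0 k1 k2 : nat) : nat :=
  let c0 := (m1 + k0)%N in
  let c1 := (m2 + (k1 + m1))%N in
  let c2 := (k2 + m2)%N in
  (c0 * k0 + (c0 + c1) * (k0 + k1) + (c0 + c1 + c2) * (k0 + k1 + k2))%N.

Definition is_torsion (F : fieldType) (m1 m2 k0 k1 k2 : nat)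
    (d1 : 'M[F]_(m2 + (k1 + m1), m1 + k0))
    (d2 : 'M[F]_(k2 + m2, m2 + (k1 + m1)))
    (h0 : 'M[F]_(k0, m1 + k0))
    (h1 : 'M[F]_(k1, m2 + (k1 + m1)))
    (h2 : 'M[F]_(k2, k2 + m2)) (t : F) : Prop :=
  exists (b1 : 'M[F]_(m1, m2 + (k1 + m1))) (b2 : 'M[F]_(m2, k2 + m2)),
    [/\ row_free (b1 *m d1) /\ (b1 *m d1 == d1)%MS,
        row_free (b2 *m d2) /\ (b2 *m d2 == d2)%MS
      & t = (-1) ^+ torsion_sign m1 m2 k0 k1 k2
            * ((\det (col_mx (b1 *m d1) h0))^-1
               * \det (col_mx (b2 *m d2) (col_mx h1 b1))
               * (\det (col_mx h2 b2))^-1)].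

(* A homomorphism rho : G_{p,q} -> SL_2(C) is given by the pair
   (rho(alpha), rho(beta)). *)
Definition rep (R : realType) := ('M[R[i]]_2 * 'M[R[i]]_2)%type.

Definition is_rep (R : realType) (p q : nat) (rho : rep R) : Prop :=
  [/\ \det rho.1 = 1, \det rho.2 = 1 & rho.1 ^+ p = rho.2 ^+ q].

Definition ev (R : realType) (rho : rep R) (w : word) : 'M[R[i]]_2 :=
  \prod_(l <- w)
    (let M := if l.1 == alpha then rho.1 else rho.2 in if l.2 then M^-1 else M).

(* The transpose is there because C^2 consists of column vectors, while a
   subspace is stored as the row space of U. *)
Definition irreducible_rep (R : realType) (rho : rep R) : Prop :=
  forall U : 'M[R[i]]_2, (forall w, stablemx U (ev rho w)^T) ->
    \rank U = 0%N \/ \rank U = 2%N.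

Definition conj_rep (R : realType) (rho rho' : rep R) : Prop :=
  exists2 S : 'M[R[i]]_2, \det S = 1 &
    rho' = (S * rho.1 * S^-1, S * rho.2 * S^-1).

Definition conj_class (R : realType) (rho : rep R) : set (rep R) :=
  [set rho' | conj_rep rho rho'].

(* sl_2(C) in coordinates with respect to the basis e, h, f. *)
Definition sl2_mx (R : realType) (v : 'rV[R[i]]_3) : 'M[R[i]]_2 :=
  v 0 0 *: delta_mx 0 1 + v 0 1 *: (delta_mx 0 0 - delta_mx 1 1)
  + v 0 ord_max *: delta_mx 1 0.

Definition sl2_coord (R : realType) (M : 'M[R[i]]_2) : 'rV[R[i]]_3 :=
  \row_k [:: M 0 1; M 0 0; M 1 0]`_k.

(* The right action x . g = Ad(rho(g))^-1 x of the group ring on sl_2(C), as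
   matrices acting on row vectors; ad_inv M is the matrix of Ad(M)^-1. *)
Definition ad_inv (R : realType) (M : 'M[R[i]]_2) : 'M[R[i]]_3 :=
  lin1_mx (fun v => sl2_coord (M^-1 * sl2_mx v * M)).

Definition act (R : realType) (rho : rep R) (z : gring) : 'M[R[i]]_3 :=
  \sum_(t <- z) ad_inv (ev rho t.2) *~ t.1.

(* E_{p,q} is a union of two solid tori glued along an annulus, so it collapses
   onto the 2-complex of the presentation (one vertex, edges alpha and beta,
   one face); the torsion is computed from the cells of this complex. Chains
   x (x) e~ are written as rows, and d(e~_2) = sum_x (d_x relator) x~,
   d(x~) = (x - 1) e~_0. *)
Definition tw_d2 (R : realType) (p q : nat) (rho : rep R) : 'M[R[i]]_(3, 3 + 3) :=
  row_mx (act rho (fox alpha (relator p q))) (act rho (fox beta (relator p q))).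

Definition tw_d1 (R : realType) (rho : rep R) : 'M[R[i]]_(3 + 3, 3) :=
  col_mx (act rho [:: (1, [:: (alpha, false)]); (-1, [::])])
         (act rho [:: (1, [:: (beta, false)]); (-1, [::])]).

(* P (x) mu~. *)
Definition tw_h1 (R : realType) (r s : int) (rho : rep R) (P : 'rV[R[i]]_3) :
    'rV[R[i]]_(3 + 3) :=
  row_mx (P *m act rho (fox alpha (meridian r s)))
         (P *m act rho (fox beta (meridian r s))).

(* The boundary torus as a 2-chain of the universal cover of the 2-complex.
   With h the fibre and R the relator, in the free group
     h mu h^-1 mu^-1 = (alpha^-r R alpha^r) (mu R^-1 mu^-1)
   (see torus_identity), so the torus with oriented basis (h, mu) is
   (alpha^-r - mu) e~_2. This is the boundary orientation (outward normal
   first) of the exterior of the positive torus knot, for which (mu, lambda) is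
   a positive basis of the boundary of the tubular neighbourhood. The opposite
   orientation changes the sign of the torsion. *)
Definition boundary_torus (r s : int) : gring :=
  [:: (1, wpow alpha (- r)); (-1, meridian r s)].

(* Here h = alpha^p, k = beta^q, u = alpha^-r and v = beta^s. *)
Lemma torus_identity (G : groupType) (h k u v : G) :
  commute u h -> commute v k ->
  (h * (u * v) * h^-1 * (u * v)^-1 =
   (u * (h * k^-1) * u^-1) * ((u * v) * (h * k^-1)^-1 * (u * v)^-1))%g.
Proof.
move=> uh vk.
rewrite !invgM !invgK !mulgA mulgVK -(mulgA _ v k) vk !mulgA mulgVK.
by rewrite uh.
Qed.

Definition tw_h2 (R : realType) (r s : int) (rho : rep R) (P : 'rV[R[i]]_3) :
    'rV[R[i]]_3 :=
  P *m act rho (boundary_torus r s).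

(* The complex C_*(E; R), which fixes the sign: H_0 and H_1 have the bases
   [pt] and [mu], and H_2 = 0. *)
Definition re_d2 (R : realType) (p q : nat) : 'M[R]_(1, 1 + 1) :=
  row_mx (aug (fox alpha (relator p q)))%:~R%:M
         (aug (fox beta (relator p q)))%:~R%:M.

Definition re_h1 (R : realType) (r s : int) : 'M[R]_(1, 1 + 1) :=
  row_mx (aug (fox alpha (meridian r s)))%:~R%:M
         (aug (fox beta (meridian r s)))%:~R%:M.

Definition is_real_torsion (R : realType) (p q : nat) (r s : int) (t : R) : Prop :=
  @is_torsion R 0 1 1 1 0 0 (re_d2 R p q) 1%:M (re_h1 R r s) 0 t.

(* The sign-refined adjoint torsion sgn(t0) t, t0 being the real torsion; the
   ranks are those of an irreducible rho, for which H_0 = 0 and H_1 and H_2 are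
   one-dimensional. *)
Definition is_adjoint_torsion (R : realType) (p q : nat) (r s : int)
    (rho : rep R) (T : R[i]) : Prop :=
  exists (P : 'rV[R[i]]_3) (t0 : R) (t : R[i]),
    [/\ P != 0,
        P *m ad_inv (ev rho (meridian r s)) = P /\
        P *m ad_inv (ev rho (fibre p)) = P,
        is_real_torsion p q r s t0,
        @is_torsion R[i] 3 2 0 1 1 (tw_d1 rho) (tw_d2 p q rho)
          0 (tw_h1 r s rho P) (tw_h2 r s rho P) t
      & T = (Num.sg t0)%:C * t].

(* The torsion of a conjugacy class. *)
Definition adjoint_torsion (R : realType) (p q : nat) (r s : int)
    (X : set (rep R)) : R[i] :=
  xget 0 [set T | exists2 rho, X rho & is_adjoint_torsion p q r s rho T].

(* tr_mu^-1(c), as a set of conjugacy classes. *)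
Definition tr_level (R : realType) (p q : nat) (r s : int) (c : R[i]) :
    set (set (rep R)) :=
  [set X | exists rho : rep R,
     [/\ is_rep p q rho, irreducible_rep rho,
         \tr (ev rho (meridian r s)) = c & X = conj_class rho]].

Definition generic (R : realType) (p q : nat) (r s : int) (c : R[i]) : Prop :=
  forall a b : nat, (0 < a < p)%N -> (0 < b < q)%N -> odd a = odd b ->
    let x : R := a%:R * r%:~R * pi / p%:R in
    let y : R := b%:R * s%:~R * pi / q%:R in
    c <> (2 * cos (x + y))%:C /\ c <> (2 * cos (x - y))%:C.

(* Main.v *)
Require Import Defs.
From HB Require Import structures.
From mathcomp Require Import all_boot all_order all_algebra.
From mathcomp Require Import complex.
From mathcomp Require Import boolp classical_sets functions cardinality fsbigop reals trigo.
From mathcomp Require Import ring zify.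
Set Implicit Arguments.
Unset Strict Implicit.
Unset Printing Implicit Defensive.
Import Order.TTheory GRing.Theory Num.Theory.

Local Open Scope ring_scope.
Local Open Scope complex_scope.

(** An irreducible representation sends alpha^p = beta^q to a central element
    +-1, so up to conjugation alpha goes to diag(u, 1/u) and beta to
    v E + v^-1 (1 - E), where u = exp(i pi a / p), v = exp(i pi b / q), a and b
    have the same parity, and E = (e, 1; e (1 - e), 1 - e) is idempotent. The
    trace of the meridian is an affine function of e, so a generic level set has
    one point for each pair (a, b).

    Multiplying the based twisted complex on the right by two suitable matrices
    makes the bases block triangular whatever the choices made, and the torsion
    becomes a quotient of two explicit determinants. It equals
    p q / (chord (u^2) chord (v^2)), where chord z = 2 - z - 1/z.

    For an n-th root of unity z <> 1 one has 2 n / chord z = - sum k (n - k) z^k.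
    Hence 2 T is the product of 2 p / chord (u^2) and q / chord (v^2), both of
    them integral combinations of roots of unity, because k (q - k) is even for
    q odd. The sum over the b of a given parity is half of the sum over all b,
    as b |-> q - b reverses the parity; therefore the sum over (a, b) factors.
    Both factors are integers: over all z <> 1 with z^n = 1, z^k has the sum
    n - 1 or -1, and z^k + z^-k has an even sum. *)

(** * Integrality of sums over roots of unity *)

Definition integral (F : numFieldType) (x : F) : Prop := exists n : int, x = n%:~R.

Section Integral.
Variable F : numFieldType.
Implicit Types x y : F.

Lemma integral_int (n : int) : integral (n%:~R : F).
Proof. by exists n. Qed.

Lemma integral_nat (n : nat) : integral (n%:R : F).
Proof. by exists n%:Z. Qed.

Lemma integralD x y : integral x -> integral y -> integral (x + y).
Proof. by move=> [m ->] [n ->]; exists (m + n); rewrite rmorphD. Qed.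

Lemma integralN x : integral x -> integral (- x).
Proof. by move=> [m ->]; exists (- m); rewrite rmorphN. Qed.

Lemma integralM x y : integral x -> integral y -> integral (x * y).
Proof. by move=> [m ->] [n ->]; exists (m * n); rewrite rmorphM. Qed.

Lemma integral_sum (I : Type) (r : seq I) (P : pred I) (f : I -> F) :
  (forall i, integral (f i)) -> integral (\sum_(i <- r | P i) f i).
Proof.
move=> fZ; elim/big_ind: _ => //; last exact: integralD.
exact: (integral_nat 0).
Qed.

(** The class [S] is stable under multiplication by each [chi j], hence by the integral combination
    [G], so by induction from the constant 1 it contains all powers of [G]. The sum of [f] alone is
    a separate clause because in one of the two uses [chi 0] is the constant 2. *)
Lemma integral_sum_exp (I : Type) (r : seq I) (P : pred I) (chi : int -> I -> F)
    (S := fun f : I -> F => integral (\sum_(i <- r | P i) f i) /\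
            forall k, integral (\sum_(i <- r | P i) f i * chi k i))
    (m : nat) (e : nat -> int) (G : I -> F) (n : nat) :
  S (fun=> 1) -> (forall f j, S f -> S (fun i => f i * chi j i)) ->
  (forall i, P i -> G i = \sum_(k < m) (e k)%:~R * chi k i) ->
  integral (\sum_(i <- r | P i) G i ^+ n).
Proof.
move=> S1 SM GE; suff [//] : S (fun i => G i ^+ n).
elim: n => [|n [IH1 IH2]]; first exact: S1.
have SG f : S f -> integral (\sum_(i <- r | P i) f i * G i).
  move=> [_ fS].
  under eq_bigr => i Pi do rewrite GE // mulr_sumr.
  rewrite exchange_big /=; apply: integral_sum => k.
  under eq_bigr => i Pi do rewrite mulrCA.
  by rewrite -mulr_sumr; apply: integralM (integral_int _) (fS _).
split.
  under eq_bigr => i Pi do rewrite exprSr.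
  by apply: SG.
move=> k; under eq_bigr => i Pi do rewrite exprSr mulrAC.
by apply: SG; apply: SM.
Qed.

Lemma sum_powers_unity_root (n : nat) x : x ^+ n = 1 ->
  \sum_(0 <= a < n) x ^+ a = if x == 1 then n%:R else 0.
Proof.
case: eqP => [-> _|/eqP x1 xn].
  by under eq_bigr do rewrite expr1n; rewrite sumr_const_nat subn0.
have := subrX1 x n; rewrite xn subrr big_mkord => /esym/eqP.
by rewrite mulf_eq0 subr_eq0 (negPf x1) => /eqP.
Qed.

Lemma sum1_powers_unity_root (n : nat) x : (0 < n)%N -> x ^+ n = 1 ->
  \sum_(1 <= a < n) x ^+ a = (if x == 1 then n%:R else 0) - 1.
Proof.
move=> n0 /sum_powers_unity_root <-.
by rewrite [in RHS]big_ltn // expr0 addrAC subrr add0r.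
Qed.

Lemma sum_quadratic_unity_root (n : nat) x : (0 < n)%N -> x ^+ n = 1 -> x != 1 ->
  \sum_(k < n) (k * (n - k))%:R * x ^+ k = - (n%:R *+ 2) / (2 - x - x^-1).
Proof.
move=> n0 xn x1.
have x0 : x != 0.
  by apply: contra_eq_neq xn => ->; rewrite expr0n gtn_eqF // eq_sym oner_neq0.
have y0 : 1 - x != 0 by rewrite subr_eq0 eq_sym.
(* x^m Q(m) has the increments (1 - x)^3 m (n - m) x^m. *)
pose Q (m : F) := (1 - x) ^+ 2 * m ^+ 2 + (2 * x * (1 - x) - n%:R * (1 - x) ^+ 2) * m
   + x * (1 + x - n%:R * (1 - x)).
have H m : (m <= n)%N ->
    (1 - x) ^+ 3 * (\sum_(k < m) (k * (n - k))%:R * x ^+ k) = x ^+ m * Q m%:R - Q 0.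
  elim: m => [_|m IH mn]; first by rewrite big_ord0 mulr0 mul1r subrr.
  rewrite big_ord_recr /= mulrDr IH ?(ltnW mn) // natrM natrB ?(ltnW mn) //.
  by rewrite /Q [x ^+ m.+1]exprS -[m.+1]addn1 natrD; ring.
(* At [m = n] the factor [x ^+ n] is 1, and [Q n - Q 0] collapses to 2 n x (1 - x). *)
have {}H := H n (leqnn _); rewrite xn in H.
have -> : 2 - x - x^-1 = - (1 - x) ^+ 2 / x by field.
apply: (mulfI (expf_neq0 3 y0)); rewrite H /Q.
by field; rewrite y0 x0.
Qed.

(* For |x| = 1 this is |1 - x|^2. *)
Definition chord (x : F) : F := 2 - x - x^-1.

Lemma chordV x : chord x^-1 = chord x.
Proof. by rewrite /chord invrK addrAC. Qed.

Lemma prim_root_neq0 (n : nat) x : n.-primitive_root x -> x != 0.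
Proof.
move=> xP; apply: contra_eq_neq (prim_expr_order xP) => ->.
by rewrite expr0n gtn_eqF ?(prim_order_gt0 xP) // eq_sym oner_neq0.
Qed.

Lemma prim_root_exp_neq1 (n : nat) x a :
  n.-primitive_root x -> (0 < a < n)%N -> x ^+ a != 1.
Proof.
move=> xP /andP[a0 an]; rewrite -(prim_order_dvd xP).
by apply/negP => /(dvdn_leq a0); rewrite leqNgt an.
Qed.

(** * Sums over all nontrivial roots of unity *)

Section Full.
Variables (p : nat) (w : F).
Hypothesis wP : p.-primitive_root w.

(** Serves the exponent -1. For [p > 1] the constant 2 contributes 2 (p - 1), and the sums of
    [w ^+ a] and of its inverse are -1 each; for [p = 1] the range is empty, whence the boolean
    factor. *)
Lemma sum_prim_chord : \sum_(1 <= a < p) chord (w ^+ a) = (p%:R *+ 2) *+ (1 < p)%N.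
Proof.
have p0 := prim_order_gt0 wP; have wn := prim_expr_order wP.
rewrite /chord; under eq_bigr do rewrite -exprVn.
rewrite !sumrB sumr_const_nat !sum1_powers_unity_root // ?exprVn ?wn ?invr1 //.
rewrite invr_eq1; case: (ltnP 1 p) => [p1|p1].
  have := prim_root_exp_neq1 wP (a := 1); rewrite p1 => /(_ isT); rewrite expr1.
  by move=> /negPf ->; rewrite -(mulr_natl 2 (p - 1)) natrB //= mulr1n; ring.
have p1' : p = 1%N by apply/eqP; rewrite eqn_leq p1 p0.
by have := wn; rewrite p1' expr1 => ->; rewrite eqxx /= mulr0n; ring.
Qed.

(** The characters w^(k a) multiply by adding their exponents [k], and their sums over nonzero [a]
    are [p - 1] or -1; [sum_quadratic_unity_root] expands the summand in them with integer
    coefficients. *)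
Lemma integral_sum_chord_exp (n : nat) :
  integral (\sum_(1 <= a < p) (p%:R *+ 2 / chord (w ^+ a)) ^+ n).
Proof.
have p0 := prim_order_gt0 wP; have wn := prim_expr_order wP.
have w0 := prim_root_neq0 wP.
have wk (k : int) : (w ^ k) ^+ p = 1.
  by rewrite exprnP exprz_exp mulrC -exprz_exp -exprnP wn exp1rz.
rewrite big_nat_cond.
apply: (integral_sum_exp (chi := fun k a => (w ^ k) ^+ a) (m := p)
          (e := fun k => - (k * (p - k))%:Z)).
- rewrite -big_nat_cond sumr_const_nat; split; first exact: integral_nat.
  move=> k; rewrite -big_nat_cond; under eq_bigr do rewrite mul1r.
  rewrite sum1_powers_unity_root // -[1]/(1%N%:R).
  by apply: integralD; [case: eqP => _; [|rewrite -[0]/(0%N%:R)]|apply: integralN];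
    exact: integral_nat.
- move=> f j [fZ fS]; split; first exact: fS.
  move=> k; under eq_bigr do rewrite -mulrA -exprMn -expfzDr //.
  exact: fS.
- move=> a /andP[a1p _].
  have xn : (w ^+ a) ^+ p = 1 by rewrite exprAC wn expr1n.
  have := sum_quadratic_unity_root p0 xn (prim_root_exp_neq1 wP a1p).
  rewrite -/(chord _) mulNr => E; rewrite -[LHS]opprK -E -sumrN; apply: eq_bigr => k _.
  by rewrite rmorphN mulNr -exprnP exprAC.
Qed.

End Full.

(** * Sums over the exponents of one parity, for odd [q] *)

Section Half.
Variables (q : nat) (w : F).
Hypotheses (q_odd : odd q) (wP : q.-primitive_root w).

Lemma sum_odd_rev (f : nat -> F) (e : bool) :
  (forall b, (0 < b < q)%N -> f (q - b)%N = f b) ->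
  \sum_(1 <= b < q | odd b == e) f b = \sum_(1 <= b < q | odd b == ~~ e) f b.
Proof.
move=> fV; rewrite big_nat_rev /= add1n [RHS]big_nat_cond big_nat_cond.
apply: eq_big => [b|b /andP[b1q _]]; last by rewrite subSS fV.
apply/andP/andP => -[b1q h]; move: (b1q) => /andP[b0 bq]; split=> //.
  by move: h; rewrite subSS oddB 1?ltnW // q_odd; case: (odd b) e => -[].
by rewrite subSS oddB 1?ltnW // q_odd; case: (odd b) e h => -[].
Qed.

Lemma sum_odd_half (f : nat -> F) (e : bool) :
  (forall b, (0 < b < q)%N -> f (q - b)%N = f b) ->
  \sum_(1 <= b < q | odd b == e) f b = (\sum_(1 <= b < q) f b) / 2.
Proof.
move=> fV; rewrite [X in _ = X / 2](bigID (fun b => odd b == e)) /=.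
rewrite [X in (_ + X) / 2](_ : _ = \sum_(1 <= b < q | odd b == ~~ e) f b); last first.
  by apply: eq_bigl => b; case: (odd b) e => -[].
by rewrite -sum_odd_rev //; field.
Qed.

Lemma prim_root_rev b : (0 < b < q)%N -> w ^+ (q - b) = (w ^+ b)^-1.
Proof.
move=> /andP[b0 bq]; have w0 := prim_root_neq0 wP.
by rewrite expfB // (prim_expr_order wP) div1r.
Qed.

Lemma chord_rev b : (0 < b < q)%N -> chord (w ^+ (q - b)) = chord (w ^+ b).
Proof. by move=> b1q; rewrite prim_root_rev // chordV. Qed.

Lemma sum_prim_chord_half e :
  \sum_(1 <= b < q | odd b == e) chord (w ^+ b) = q%:R *+ (1 < q)%N.
Proof.
rewrite sum_odd_half; last exact: chord_rev.
by rewrite sum_prim_chord //; case: (1 < q)%N => /=; field.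
Qed.

(** The functions [chi k b] = w^(k b) + w^(-k b) are invariant under b |-> q - b, so their sums over
    one parity are half of the full sums, that is [q - 1] or -1. They satisfy chi_j chi_k =
    chi_(j+k) + chi_(j-k). Folding k with q - k in the expansion of the summand gives [chi k] the
    coefficient - k (q - k) / 2, an integer as [q] is odd. *)
Lemma integral_sum_chord_exp_half (n : nat) e :
  integral (\sum_(1 <= b < q | odd b == e) (q%:R / chord (w ^+ b)) ^+ n).
Proof.
have q0 := prim_order_gt0 wP; have wn := prim_expr_order wP.
have w0 := prim_root_neq0 wP.
have wk (k : int) : (w ^ k) ^+ q = 1.
  by rewrite exprnP exprz_exp mulrC -exprz_exp -exprnP wn exp1rz.
pose chi (k : int) b : F := (w ^ k) ^+ b + (w ^ (- k)) ^+ b.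
have chiZ k : integral (\sum_(1 <= b < q | odd b == e) chi k b).
  rewrite sum_odd_half => [|b /andP[b0 bq]]; last first.
    have wz0 j : w ^ j != 0 by rewrite expfz_neq0.
    by rewrite /chi !expfB // !wk !div1r -!exprVn !invr_expz opprK addrC.
  rewrite big_split /= !sum1_powers_unity_root // -!invr_expz invr_eq1.
  rewrite -mulr2n -[_ *+ 2]mulr_natr mulfK ?pnatr_eq0 //.
  apply: integralD; last exact/integralN/(integral_nat 1).
  by case: eqP => _; [|rewrite -[0]/(0%N%:R)]; exact: integral_nat.
rewrite big_nat_cond.
apply: (integral_sum_exp (chi := chi) (m := q./2.+1)
          (e := fun k => - (k * (q - k) %/ 2)%:Z)).
- rewrite -big_nat_cond; split; last first.
    by move=> k; rewrite -big_nat_cond; under eq_bigr do rewrite mul1r.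
  by apply: integral_sum => i; exact: (integral_nat 1).
- move=> f j [fZ fS]; split; first exact: fS.
  move=> k; rewrite [X in integral X](_ : _ =
    \sum_(1 <= i < q | (1 <= i < q)%N && (odd i == e)) f i * chi (j + k) i +
    \sum_(1 <= i < q | (1 <= i < q)%N && (odd i == e)) f i * chi (j - k) i).
    exact: integralD.
  rewrite -big_split; apply: eq_bigr => i _ /=; rewrite -mulrA -mulrDr /chi; congr (_ * _).
  rewrite mulrDl !mulrDr -!exprMn -!expfzDr // opprD opprB [k - j]addrC; ring.
- move=> b /andP[b1q _].
  have xn : (w ^+ b) ^+ q = 1 by rewrite exprAC wn expr1n.
  have := sum_quadratic_unity_root q0 xn (prim_root_exp_neq1 wP b1q).
  rewrite -/(chord _).
  (* The term 0 has weight 0; the terms 1 to q/2 and q/2 + 1 to q - 1 are paired by reversing the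
     second range. *)
  have qE : q = (q./2.+1 + q./2)%N by rewrite -[LHS]odd_double_half q_odd -addnn.
  pose S m := \sum_(k < m) (k * (q - k))%:R * (w ^+ b) ^+ k.
  rewrite -/(S q) {1}qE /S big_split_ord big_ord_recl /= mul0n mul0r add0r.
  rewrite [X in _ + X](reindex_inj rev_ord_inj) -big_split /= => E.
  rewrite big_ord_recl /= mul0n div0n oppr0 mul0r add0r.
  apply: (mulIf (_ : 2 != 0 :> F)); first by rewrite pnatr_eq0.
  rewrite mulrAC mulr_natr -[LHS]opprK -mulNr -E -sumrN mulr_suml.
  apply: eq_bigr => k _.
  have kq : (k.+1 <= q)%N by have := ltn_ord k; lia.
  have -> : (q./2.+1 + (q./2 - k.+1))%N = (q - k.+1)%N by have := ltn_ord k; lia.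
  rewrite subKn // mulnC -mulrDr /bump /= add1n.
  have xV : (w ^+ b) ^+ (q - k.+1) = (w ^ (- k.+1%:Z)) ^+ b.
    by rewrite exprB ?unitfE ?expf_neq0 // xn div1r -invr_expz -exprnP exprVn [in RHS]exprAC.
  have -> : (w ^+ b) ^+ k.+1 + (w ^+ b) ^+ (q - k.+1) = chi k.+1 b by rewrite xV exprAC.
  rewrite rmorphN !mulNr mulrAC; congr (- (_ * _)).
  rewrite -[X in _ = _ * X]/(2%:R) -natrM; congr (_%:R).
  have : ~~ odd ((q - k.+1) * k.+1) by rewrite oddM oddB // q_odd; case: (odd k.+1).
  by rewrite mulnC; lia.
Qed.

End Half.

(** Giving the factor 2 to [p] leaves one factor in [a] and one in [b]; as the sum over [b] has the
    same value for both parities, the double sum is a product. Only [g = 0] has a negative exponent: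
    there the plain sums of chords appear, and each of the two quotients is 1 or 0. *)
Lemma integral_verlinde_sum (p q : nat) (w z : F) (g : nat) :
  odd q -> p.-primitive_root w -> q.-primitive_root z ->
  integral (\sum_(1 <= a < p) \sum_(1 <= b < q | odd b == odd a)
     (2 * (p%:R * q%:R / (chord (w ^+ a) * chord (z ^+ b)))) ^ (g%:Z - 1)).
Proof.
move=> q_odd wP zP; set n := g%:Z - 1.
have E a b : (2 * (p%:R * q%:R / (chord (w ^+ a) * chord (z ^+ b)))) ^ n =
    (p%:R *+ 2 / chord (w ^+ a)) ^ n * (q%:R / chord (z ^+ b)) ^ n.
  rewrite -expfzMl; congr (_ ^ n); rewrite invfM; ring.
under eq_bigr do under eq_bigr do rewrite E.
under eq_bigr do rewrite -mulr_sumr.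
pose s e := \sum_(1 <= b < q | odd b == e) (q%:R / chord (z ^+ b)) ^ n.
have sE e : s e = s true.
  case: e => //; rewrite /s sum_odd_rev // => b b1q.
  by rewrite chord_rev.
under eq_bigr do rewrite -/(s _) sE.
rewrite -mulr_suml {sE}/s {E}/n.
case: g => [|g].
  rewrite (_ : 0%:Z - 1 = -1) //.
  under eq_bigr do rewrite exprN1 invf_div.
  under [X in _ * X]eq_bigr do rewrite exprN1 invf_div.
  rewrite -!mulr_suml sum_prim_chord // sum_prim_chord_half //.
  have p0 : p%:R != 0 :> F by rewrite pnatr_eq0 -lt0n (prim_order_gt0 wP).
  have q0 : q%:R != 0 :> F by rewrite pnatr_eq0 -lt0n (prim_order_gt0 zP).
  have -> : p%:R *+ 2 *+ (1 < p) / (p%:R *+ 2) = (1 < p)%N%:R :> F.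
    by case: (1 < p)%N; rewrite ?mulr1n ?mulr0n ?mul0r // divff // mulrn_eq0.
  have -> : q%:R *+ (1 < q) / q%:R = (1 < q)%N%:R :> F.
    by case: (1 < q)%N; rewrite ?mulr1n ?mulr0n ?mul0r // divff.
  by apply: integralM; exact: integral_nat.
have -> : g.+1%:Z - 1 = g by lia.
by apply: integralM; [exact: integral_sum_chord_exp|exact: integral_sum_chord_exp_half].
Qed.

End Integral.

(** * Torsion of based complexes *)

Section Torsion.
Variable F : fieldType.

Lemma col_mx_emptyr (X : 'M[F]_(3, 3 + 0)) (Y : 'M[F]_(0, 3 + 0)) :
  col_mx X Y = X :> 'M[F]_3.
Proof.
apply/matrixP => i j; rewrite -[RHS](col_mxEu X Y); congr (col_mx X Y _ _).
exact: val_inj.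
Qed.

Lemma rank_base (m n k : nat) (A : 'M[F]_(m, n)) : \rank A = k ->
  exists B : 'M[F]_(k, m), row_free (B *m A) /\ (B *m A == A)%MS.
Proof.
move=> <-; have /submxP[B BA] : (row_base A <= A)%MS by rewrite eq_row_base.
exists B; rewrite -BA row_base_free; split=> //; apply/eqmxP; exact: eq_row_base.
Qed.

Lemma row_full_row_mxr (m n1 n2 : nat) (A : 'M[F]_(m, n1)) (B : 'M_(m, n2)) :
  row_full (row_mx A B) -> row_full B.
Proof.
move=> full; have -> : B = row_mx A B *m col_mx 0 1%:M.
  by rewrite mul_row_col mulmx0 add0r mulmx1.
by rewrite /row_full (eqmxMfull _ full) rank_col_0mx mxrank1.
Qed.

(** The families [b1 *m G1] and [b2 *m G2] are admissible for the new complex, and each of the three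
    determinants gains the determinant of its [G]. *)
Lemma is_torsion_change_basis (m1 m2 k0 k1 k2 : nat)
    (d1 : 'M[F]_(m2 + (k1 + m1), m1 + k0)) (d2 : 'M_(k2 + m2, m2 + (k1 + m1)))
    h0 h1 h2 (G0 : 'M_(m1 + k0)) (G1 : 'M_(m2 + (k1 + m1))) (G2 : 'M_(k2 + m2)) t :
  G0 \in unitmx -> G1 \in unitmx -> G2 \in unitmx ->
  is_torsion d1 d2 h0 h1 h2 t ->
  is_torsion (invmx G1 *m d1 *m G0) (invmx G2 *m d2 *m G1)
    (h0 *m G0) (h1 *m G1) (h2 *m G2) (\det G1 / (\det G0 * \det G2) * t).
Proof.
move=> G0u G1u G2u [b1 [b2 [[f1 e1] [f2 e2] ->]]].
have HB k m n (b : 'M[F]_(k, m)) (G : 'M_m) (d : 'M_(m, n)) (G' : 'M_n) :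
    G \in unitmx -> (b *m G) *m (invmx G *m d *m G') = b *m d *m G'.
  by move=> Gu; rewrite !mulmxA mulmxK.
have f0 k m n (b : 'M[F]_(k, m)) (G : 'M_m) (d : 'M_(m, n)) (G' : 'M_n) :
    G \in unitmx -> G' \in unitmx -> row_free (b *m d) -> (b *m d == d)%MS ->
    row_free (b *m d *m G') /\ (b *m d *m G' == invmx G *m d *m G')%MS.
  move=> Gu G'u fr /eqmxP eq; split.
    by rewrite /row_free mxrankMfree // row_free_unit.
  apply/eqmxP; apply: eqmx_trans (eqmxMr _ eq) _; apply/eqmx_sym/eqmxMr.
  by apply: eqmxMfull; rewrite row_full_unit unitmx_inv.
exists (b1 *m G1), (b2 *m G2); rewrite !HB //; split; [exact: f0|exact: f0|].
rewrite -!mul_col_mx !det_mulmx !invfM mulrCA; congr (_ * _); ring.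
Qed.

(* Multiplying the bases of the complex on the right by the matrices of J and K
   makes them block triangular, so the torsion does not depend on b1, b2. *)
Lemma is_torsionP (d1 : 'M[F]_(2 + (1 + 3), 3 + 0)) (d2 : 'M[F]_(1 + 2, 2 + (1 + 3)))
    h0 h1 h2 (psi : 'M_(2 + (1 + 3), 2)) (theta : 'M_(2 + (1 + 3), 1))
    (xi : 'M_(1 + 2, 1)) (t : F)
    (J := row_mx psi (row_mx theta d1) : 'M[F]_6)
    (K := row_mx xi (d2 *m psi) : 'M[F]_3) :
  d2 *m d1 = 0 -> h1 *m d1 = 0 -> h2 *m d2 = 0 ->
  d2 *m theta = 0 -> h1 *m theta = h2 *m xi -> h2 *m xi != 0 ->
  \det J != 0 -> \det K != 0 ->
  is_torsion d1 d2 h0 h1 h2 t <-> t = - (\det K / \det J).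
Proof.
move=> d21 h1d1 h2d2 d2th h1th h2xi J0 K0.
have psi_full : row_full (d2 *m psi).
  apply: (@row_full_row_mxr _ _ _ xi); rewrite row_full_unit unitmxE unitfE.
  exact: K0.
have d1_full : row_full d1.
  apply: (@row_full_row_mxr _ _ _ theta); apply: (@row_full_row_mxr _ _ _ psi).
  by rewrite row_full_unit unitmxE unitfE; exact: J0.
have d1_rank : \rank d1 = 3%N by apply/eqP; exact: d1_full.
have d2_rank : \rank d2 = 2%N.
  have r2 : (2 <= \rank d2)%N.
    by apply: leq_trans (mxrankM_maxl d2 psi); rewrite (eqP psi_full).
  (* Rank 3 would make [d2] injective, which the nonzero cycle [h2] excludes. *)
  apply/eqP; rewrite eqn_leq r2 andbT leqNgt.
  apply: contra h2xi => r3; have d2f : row_free d2.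
    by rewrite /row_free eqn_leq rank_leq_row.
  by rewrite (_ : h2 = 0) ?mul0mx //; apply/eqP; rewrite -(mulmx_free_eq0 _ d2f) h2d2.
have c0 : (h2 *m xi) 0 0 != 0.
  by apply: contraNneq h2xi => E; apply/eqP/matrixP => i j; rewrite !ord1 E mxE.
have eval (b1 : 'M[F]_(3, 2 + (1 + 3))) (b2 : 'M[F]_(2, 1 + 2)) :
    row_free (b1 *m d1) -> (b2 *m d2 == d2)%MS ->
    (-1) ^+ torsion_sign 3 2 0 1 1 * ((\det (col_mx (b1 *m d1) h0))^-1
               * \det (col_mx (b2 *m d2) (col_mx h1 b1))
               * (\det (col_mx h2 b2))^-1) = - (\det K / \det J).
  move=> f1 /eqmxP e2.
  set M1 := col_mx (b2 *m d2) (col_mx h1 b1); set M2 := col_mx h2 b2.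
  (* Both products are block lower triangular, with diagonal blocks [b2 d2 psi], [h1 theta = h2 xi],
     [b1 d1] here, and [h2 xi], [b2 d2 psi] in [E2]. The common factors cancel in the quotient, and
     with them the choice of [b1] and [b2]. *)
  have E1 : \det M1 * \det J = \det (b2 *m d2 *m psi) * ((h2 *m xi) 0 0 * \det (b1 *m d1 :
    'M_3)).
    rewrite -det_mulmx /M1 /J mul_col_row mul_mx_row -!mulmxA d2th d21 !mulmx0 row_mx0.
    rewrite det_lblock mul_col_row h1d1 h1th det_lblock det_mx11.
    by rewrite !mulmxA.
  have E2 : \det M2 * \det K = (h2 *m xi) 0 0 * \det (b2 *m d2 *m psi).
    rewrite -det_mulmx /M2 /K mul_col_row mulmxA h2d2 mul0mx.
    by rewrite det_lblock det_mx11 mulmxA.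
  have u1 : \det (b1 *m d1 : 'M_3) != 0.
    by rewrite -unitfE -unitmxE -row_free_unit.
  have u2 : \det (b2 *m d2 *m psi) != 0.
    rewrite -unitfE -unitmxE -row_full_unit /row_full.
    by rewrite (eqmxMr psi e2) (eqP psi_full).
  have M20 : \det M2 != 0.
    by apply: contra_eq_neq E2 => ->; rewrite mul0r eq_sym mulf_neq0.
  have -> : \det M1 = \det M2 * \det K / \det J * \det (b1 *m d1 : 'M_3).
    by apply: (mulIf J0); rewrite E1 E2; field.
  (* The sign exponent is 3 * 0 + 9 * 1 + 12 * 2 = 33, which is odd. *)
  by rewrite col_mx_emptyr /torsion_sign /= -signr_odd /= expr1; field; rewrite J0 M20 u1.
split=> [[b1 [b2 [[f1 _] [_ e2] ->]]]|->]; first exact: eval.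
have [b1 [f1 e1]] := rank_base d1_rank; have [b2 [f2 e2]] := rank_base d2_rank.
by exists b1, b2; split=> //; rewrite eval.
Qed.

End Torsion.

(** * Matrices of size 2 and 3, the adjoint action *)

Section SmallMatrices.
Variable F : comUnitRingType.

Definition mx2 (a b c d : F) : 'M[F]_2 :=
  \matrix_(i, j) if i == 0 then if j == 0 then a else b else if j == 0 then c else d.

Lemma ord2P (P : 'I_2 -> Prop) : P 0 -> P 1 -> forall i, P i.
Proof.
move=> P0 P1 [[|[|//]] i2].
  by rewrite (_ : Ordinal i2 = 0) //; apply: val_inj.
by rewrite (_ : Ordinal i2 = 1) //; apply: val_inj.
Qed.

Lemma ord3P (P : 'I_3 -> Prop) : P 0 -> P 1 -> P ord_max -> forall i, P i.
Proof.
move=> P0 P1 P2 [[|[|[|//]]] i3].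
- by rewrite (_ : Ordinal i3 = 0) //; apply: val_inj.
- by rewrite (_ : Ordinal i3 = 1) //; apply: val_inj.
- by rewrite (_ : Ordinal i3 = ord_max) //; apply: val_inj.
Qed.

Lemma big_ord2 (V : nmodType) (f : 'I_2 -> V) : \sum_i f i = f 0 + f 1.
Proof.
by rewrite !big_ord_recl big_ord0 addr0; congr (_ + f _); apply: val_inj.
Qed.

Lemma big_ord3 (V : nmodType) (f : 'I_3 -> V) : \sum_i f i = f 0 + f 1 + f ord_max.
Proof.
rewrite !big_ord_recl big_ord0 addr0 addrA.
by congr (_ + f _ + f _); apply: val_inj.
Qed.

Lemma mx2P (M N : 'M[F]_2) :
  M 0 0 = N 0 0 -> M 0 1 = N 0 1 -> M 1 0 = N 1 0 -> M 1 1 = N 1 1 -> M = N.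
Proof.
by move=> *; apply/matrixP; apply: ord2P; apply: ord2P.
Qed.

Lemma mx2_eta (M : 'M[F]_2) : M = mx2 (M 0 0) (M 0 1) (M 1 0) (M 1 1).
Proof. by apply: mx2P; rewrite !mxE. Qed.

Lemma mulmx2 (a b c d a' b' c' d' : F) :
  mx2 a b c d * mx2 a' b' c' d' =
  mx2 (a * a' + b * c') (a * b' + b * d') (c * a' + d * c') (c * b' + d * d').
Proof. by apply: mx2P; rewrite !mxE big_ord2 !mxE. Qed.

Lemma det_mx2 (M : 'M[F]_2) : \det M = M 0 0 * M 1 1 - M 0 1 * M 1 0.
Proof.
rewrite (expand_det_row _ 0) big_ord2 /cofactor !det_mx11 !mxE /= expr0 expr1 mul1r.
rewrite mulN1r mulrN; congr (_ * M _ _ - _ * M _ _); exact: val_inj.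
Qed.

Lemma det_mx3 (M : 'M[F]_3) : \det M =
  M 0 0 * (M 1 1 * M ord_max ord_max - M 1 ord_max * M ord_max 1)
  - M 0 1 * (M 1 0 * M ord_max ord_max - M 1 ord_max * M ord_max 0)
  + M 0 ord_max * (M 1 0 * M ord_max 1 - M 1 1 * M ord_max 0).
Proof.
rewrite (expand_det_row _ 0) big_ord3 /cofactor !det_mx2 !mxE /= expr0 expr1 -signr_odd /=
  expr0.
have l00 : lift 0 (0 : 'I_2) = 1 :> 'I_3 by apply: val_inj.
have l01 : lift 0 (1 : 'I_2) = ord_max :> 'I_3 by apply: val_inj.
have l10 : lift 1 (0 : 'I_2) = 0 :> 'I_3 by apply: val_inj.
have l11 : lift 1 (1 : 'I_2) = ord_max :> 'I_3 by apply: val_inj.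
have l20 : lift ord_max (0 : 'I_2) = 0 :> 'I_3 by apply: val_inj.
have l21 : lift ord_max (1 : 'I_2) = 1 :> 'I_3 by apply: val_inj.
by rewrite l00 l01 l10 l11 l20 l21; ring.
Qed.

Lemma mx2_inv (M : 'M[F]_2) : \det M = 1 -> M^-1 = mx2 (M 1 1) (- M 0 1) (- M 1 0) (M 0 0).
Proof.
move=> dM; have Mu : M \is a GRing.unit by rewrite -[_ \is a _]/(_ \in unitmx) unitmxE dM
  unitr1.
apply: (mulrI Mu); rewrite mulrV // {1}[M]mx2_eta mulmx2.
by rewrite det_mx2 in dM; apply: mx2P; rewrite !mxE -?dM /=; ring.
Qed.

Definition mx3 (a b c d e f g h k : F) : 'M[F]_3 :=
  \matrix_(i, j) nth 0 (nth [::] [:: [:: a; b; c]; [:: d; e; f]; [:: g; h; k]] i) j.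

Lemma mx3P (M N : 'M[F]_3) :
  M 0 0 = N 0 0 -> M 0 1 = N 0 1 -> M 0 ord_max = N 0 ord_max ->
  M 1 0 = N 1 0 -> M 1 1 = N 1 1 -> M 1 ord_max = N 1 ord_max ->
  M ord_max 0 = N ord_max 0 -> M ord_max 1 = N ord_max 1 ->
  M ord_max ord_max = N ord_max ord_max -> M = N.
Proof.
by move=> *; apply/matrixP; apply: ord3P; apply: ord3P.
Qed.

(* The matrix of X |-> adj(M) X M on traceless X, in the basis e, h, f. *)
Definition adj_mx (M : 'M[F]_2) : 'M[F]_3 := mx3
  (M 1 1 ^+ 2) (M 1 0 * M 1 1) (- M 1 0 ^+ 2)
  (2 * M 0 1 * M 1 1) (M 0 0 * M 1 1 + M 0 1 * M 1 0) (- (2 * M 0 0 * M 1 0))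
  (- M 0 1 ^+ 2) (- (M 0 0 * M 0 1)) (M 0 0 ^+ 2).

Lemma adj_mxM (M N : 'M[F]_2) : adj_mx (M * N) = adj_mx M * adj_mx N.
Proof.
rewrite [M]mx2_eta [N]mx2_eta; move: (M 0 0) (M 0 1) (M 1 0) (M 1 1).
move: (N 0 0) (N 0 1) (N 1 0) (N 1 1) => *; rewrite mulmx2.
by apply: mx3P; rewrite !mxE big_ord3 !mxE /=; ring.
Qed.

Lemma adj_mx1 : adj_mx 1 = 1.
Proof. by apply: mx3P; rewrite !mxE /=; ring. Qed.

End SmallMatrices.

Section Adjoint.
Variable R : realType.
Implicit Types M N : 'M[R[i]]_2.

Lemma sl2_mx_mx2 (v : 'rV[R[i]]_3) : sl2_mx v = mx2 (v 0 1) (v 0 0) (v 0 ord_max) (- v 0 1).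
Proof. by apply: mx2P; rewrite !mxE /=; ring. Qed.

(** Names the map under [lin1_mx] in [ad_inv], so that a linear structure can be attached to it. *)
Definition ad_inv_fun M (v : 'rV[R[i]]_3) := sl2_coord (M^-1 * sl2_mx v * M).

Lemma ad_inv_fun_linear M : linear (ad_inv_fun M).
Proof.
move=> c u v.
have E : sl2_mx (c *: u + v) = c *: sl2_mx u + sl2_mx v.
  by rewrite !sl2_mx_mx2; apply: mx2P; rewrite !mxE /=; ring.
rewrite /ad_inv_fun E mulrDr mulrDl -scalerAr -scalerAl.
by apply/rowP; apply: ord3P; move: (_ * M) (_ * M) => X Y; rewrite !mxE.
Qed.

HB.instance Definition _ M :=
  GRing.isLinear.Build _ _ _ _ (ad_inv_fun M) (ad_inv_fun_linear M).

Lemma mul_ad_inv M v : v *m ad_inv M = sl2_coord (M^-1 * sl2_mx v * M).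
Proof. exact: (mul_rV_lin1 (ad_inv_fun M)). Qed.

Lemma sl2_coordK M : \tr M = 0 -> sl2_mx (sl2_coord M) = M.
Proof.
rewrite /mxtrace big_ord2 sl2_mx_mx2 => /eqP; rewrite addr_eq0 => /eqP M00.
by apply: mx2P; rewrite !mxE //= M00 opprK.
Qed.

Lemma mxtrace_sl2 v : \tr (sl2_mx v : 'M[R[i]]_2) = 0.
Proof. by rewrite /mxtrace big_ord2 sl2_mx_mx2 !mxE subrr. Qed.

(** The inverse in Ad(M)^-1 and the action on row vectors reverse the order of factors once each, so
    the order is preserved. *)
Lemma ad_invM M N : M \is a GRing.unit -> N \is a GRing.unit ->
  ad_inv (M * N) = ad_inv M * ad_inv N.
Proof.
move=> Mu Nu; apply/row_matrixP => i; rewrite !rowE -mulmxE mulmxA !mul_ad_inv.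
rewrite sl2_coordK ?invrM // ?mulrA //.
by rewrite -mulmxE mxtrace_mulC mulmxE mulrA divrr // mul1r mxtrace_sl2.
Qed.

Lemma ad_inv1 : ad_inv 1 = 1 :> 'M[R[i]]_3.
Proof.
apply/row_matrixP => i; rewrite !rowE mul_ad_inv invr1 mul1r mulr1 mulmx1 sl2_mx_mx2.
by apply/rowP; apply: ord3P; rewrite !mxE.
Qed.

(** On SL_2 the inverse is the adjugate, so the adjoint action has polynomial entries and explicit
    computations become ring identities. *)
Lemma ad_inv_adj_mx M : \det M = 1 -> ad_inv M = adj_mx M.
Proof.
move=> dM; apply/row_matrixP => i; rewrite !rowE mul_ad_inv mx2_inv //.
rewrite sl2_mx_mx2 {5}[M]mx2_eta !mulmx2; move: i.
apply: ord3P; rewrite -rowE; apply/rowP; apply: ord3P; rewrite !mxE /=; ring.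
Qed.

Lemma ad_inv_unit M : M \is a GRing.unit -> ad_inv M \is a GRing.unit.
Proof.
move=> Mu; apply/unitrP; exists (ad_inv M^-1).
by rewrite -!ad_invM ?unitrV // divrr // mulVr // ad_inv1.
Qed.

Lemma ad_invV M : M \is a GRing.unit -> ad_inv M^-1 = (ad_inv M)^-1.
Proof.
move=> Mu; apply: (mulrI (ad_inv_unit Mu)).
by rewrite -ad_invM ?unitrV // !divrr ?ad_inv1 // ad_inv_unit.
Qed.

End Adjoint.

(** * Fox calculus *)

Definition shift (w : word) (z : gring) : gring := [seq (t.1, w ++ t.2) | t <- z].

Lemma fox_cat x w1 w2 : fox x (w1 ++ w2) = fox x w1 ++ shift w1 (fox x w2).
Proof.
elim: w1 => [|l w IH] /=; first by rewrite /shift -[LHS]map_id; apply: eq_map => -[].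
by rewrite IH map_cat catA /shift -map_comp.
Qed.

Lemma fox_wpow_neq x y n : x != y -> fox x (wpow y n) = [::].
Proof.
by move=> xy; rewrite /wpow; elim: `|n|%N => //= k ->; rewrite eq_sym (negPf xy).
Qed.

Lemma aug_cat z1 z2 : aug (z1 ++ z2) = aug z1 + aug z2.
Proof. by rewrite /aug big_cat. Qed.

Lemma aug_shift w z : aug (shift w z) = aug z.
Proof. by rewrite /aug /shift big_map. Qed.

Lemma aug_fox_wpow x (n : int) : aug (fox x (wpow x n)) = n.
Proof.
have E b k : aug (fox x (nseq k (x, b))) = (if b then -1 else 1) *+ k.
  elim: k => [|k IH]; first by rewrite /aug big_nil.
  rewrite [nseq _ _]/= -cat1s fox_cat aug_cat aug_shift IH mulrS /= eqxx.
  by rewrite /aug; case: b {IH}; rewrite big_seq1.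
rewrite /wpow E; case: n => n; first by rewrite natz.
by rewrite NegzE mulNrn natz.
Qed.

Section FoxEval.
Variables (T : unitRingType) (a : bool -> T).
Hypothesis a_unit : forall x, a x \is a GRing.unit.

Definition word_eval (w : word) : T := \prod_(l <- w) if l.2 then (a l.1)^-1 else a l.1.

Definition gring_eval (z : gring) : T := \sum_(t <- z) word_eval t.2 *~ t.1.

Lemma word_eval_cat w1 w2 : word_eval (w1 ++ w2) = word_eval w1 * word_eval w2.
Proof. by rewrite /word_eval big_cat. Qed.

Lemma wev1 l : word_eval [:: l] = if l.2 then (a l.1)^-1 else a l.1.
Proof. by rewrite /word_eval big_seq1. Qed.

Lemma word_eval_nseq l k : word_eval (nseq k l) = word_eval [:: l] ^+ k.
Proof.
elim: k => [|k IH]; first by rewrite /word_eval big_nil.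
by rewrite [nseq _ _]/= -cat1s word_eval_cat IH exprS.
Qed.

Lemma word_eval_wpow x (n : int) : word_eval (wpow x n) = a x ^ n.
Proof. by rewrite /wpow word_eval_nseq wev1; case: n => n //=; rewrite exprVn. Qed.

Lemma gring_eval_nil : gring_eval [::] = 0.
Proof. by rewrite /gring_eval big_nil. Qed.

Lemma gring_eval_cat z1 z2 : gring_eval (z1 ++ z2) = gring_eval z1 + gring_eval z2.
Proof. by rewrite /gring_eval big_cat. Qed.

Lemma gring_eval_shift w z : gring_eval (shift w z) = word_eval w * gring_eval z.
Proof.
rewrite /gring_eval /shift big_map mulr_sumr; apply: eq_bigr => t _ /=.
by rewrite word_eval_cat mulrzAr.
Qed.

Lemma gring_eval_fox_cat x w1 w2 :
  gring_eval (fox x (w1 ++ w2)) = gring_eval (fox x w1) + word_eval w1 * gring_eval (fox x w2).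
Proof. by rewrite fox_cat gring_eval_cat gring_eval_shift. Qed.

Lemma gring_eval_fox1 x l : gring_eval (fox x [:: l]) =
  if l.1 == x then if l.2 then - (a x)^-1 else 1 else 0.
Proof.
case: l => y b /=; case: eqP => _; rewrite ?cats0 ?gring_eval_nil //.
by rewrite /gring_eval big_seq1; case: b; rewrite /= ?wev1 /word_eval ?big_nil //= mulrN1z.
Qed.

Lemma gring_eval_fox_nseq x b k : gring_eval (fox x (nseq k (x, b))) =
  if b then - \sum_(j < k) (a x)^-1 ^+ j.+1 else \sum_(j < k) a x ^+ j.
Proof.
elim: k => [|k IH]; first by rewrite gring_eval_nil !big_ord0 oppr0 if_same.
rewrite [nseq _ _]/= -cat1s gring_eval_fox_cat gring_eval_fox1 /= eqxx IH wev1.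
case: b {IH}; rewrite big_ord_recl /=.
  by rewrite mulrN -opprD expr1 mulr_sumr; congr (- (_ + _)); apply: eq_bigr => j _;
    rewrite -exprS.
by rewrite expr0 mulr_sumr; congr (_ + _); apply: eq_bigr => j _; rewrite -exprS.
Qed.

Lemma gring_eval_fox_wpow_comm x (n : int) : GRing.comm (gring_eval (fox x (wpow x n))) (a x).
Proof.
apply/commr_sym; rewrite gring_eval_fox_nseq; case: ifP => _.
  by apply/commrN/commr_sum => j _; apply/commrX/commrV.
by apply/commr_sum => j _; apply/commrX.
Qed.

(** The fundamental formula of Fox calculus: both sides are the boundary of the lift of the path
    [w]. It yields [d2 *m d1 = 0] and makes the meridian chain a cycle. *)
Lemma fox_fundamental w :
  gring_eval (fox alpha w) * (a alpha - 1) + gring_eval (fox beta w) * (a beta - 1) =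
    word_eval w - 1.
Proof.
elim: w => [|l w IH]; first by rewrite !gring_eval_nil !mul0r addr0 /word_eval big_nil subrr.
rewrite -cat1s !gring_eval_fox_cat !mulrDl -!mulrA addrACA -mulrDr IH word_eval_cat.
have -> : gring_eval (fox alpha [:: l]) * (a alpha - 1) + gring_eval (fox beta [:: l]) * (a
  beta - 1)
    = word_eval [:: l] - 1.
  rewrite !gring_eval_fox1 wev1; case: l => [[] []] /=; rewrite mul0r ?add0r ?addr0 ?mul1r //.
    by rewrite mulNr mulrBr mulVr // mulr1 opprB.
  by rewrite mulNr mulrBr mulVr // mulr1 opprB.
by rewrite mulrBr mulr1 addrC addrA subrK.
Qed.

Lemma gring_eval_fox_wpow x (n : int) : gring_eval (fox x (wpow x n)) * (a x - 1) = a x ^ n -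
  1.
Proof.
rewrite -word_eval_wpow -fox_fundamental; case: x.
  by rewrite (@fox_wpow_neq alpha true) // gring_eval_nil mul0r add0r.
by rewrite (@fox_wpow_neq beta false) // gring_eval_nil mul0r addr0.
Qed.

End FoxEval.

Section Adjoint.
Variable R : realType.
Variable rho : rep R.
Hypotheses (detA : \det rho.1 = 1) (detB : \det rho.2 = 1).

Definition gen (x : bool) : 'M[R[i]]_2 := if x == alpha then rho.1 else rho.2.

Definition ad_gen (x : bool) : 'M[R[i]]_3 := ad_inv (gen x).

Lemma unit_det1 (M : 'M[R[i]]_2) : \det M = 1 -> M \is a GRing.unit.
Proof. by move=> dM; rewrite -[_ \is a _]/(_ \in unitmx) unitmxE dM unitr1. Qed.

Lemma gen_unit x : gen x \is a GRing.unit.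
Proof. by apply: unit_det1; rewrite /gen; case: eqP. Qed.

Lemma ad_gen_unit x : ad_gen x \is a GRing.unit.
Proof. exact/ad_inv_unit/gen_unit. Qed.

Lemma ev_word_eval w : ev rho w = word_eval gen w.
Proof. by []. Qed.

Lemma ev_unit w : ev rho w \is a GRing.unit.
Proof.
rewrite ev_word_eval /word_eval; apply: rpred_prod => -[x []] _ /=; rewrite ?unitrV;
  exact: gen_unit.
Qed.

Lemma ad_inv_ev w : ad_inv (ev rho w) = word_eval ad_gen w.
Proof.
elim: w => [|[x b] w IH]; first by rewrite /ev /word_eval !big_nil ad_inv1.
rewrite -cat1s word_eval_cat -IH ev_word_eval word_eval_cat -ev_word_eval ad_invM;
  last exact: ev_unit.
  congr (_ * _); rewrite ev_word_eval !wev1; case: b; rewrite /= /ad_gen //.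
  by rewrite ad_invV ?gen_unit.
exact: (ev_unit [:: (x, b)]).
Qed.

Lemma act_gring_eval z : act rho z = gring_eval ad_gen z.
Proof. by apply: eq_bigr => t _; rewrite ad_inv_ev. Qed.

End Adjoint.

(** * The twisted complex of the torus knot group *)

Section Complex.
Variables (F : fieldType) (a : bool -> 'M[F]_3) (p q : nat) (r s : int) (P : 'rV[F]_3).
Hypotheses (a_unit : forall x, a x \is a GRing.unit)
  (aP : a alpha ^+ p = 1) (bQ : a beta ^+ q = 1)
  (mP : P *m word_eval a (meridian r s) = P).

Definition fox_d1 : 'M[F]_(3 + 3, 3) := col_mx (a alpha - 1%:M) (a beta - 1%:M).
Definition fox_d2 : 'M[F]_(3, 3 + 3) :=
  row_mx (gring_eval a (fox alpha (relator p q))) (gring_eval a (fox beta (relator p q))).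
Definition meridian_chain : 'M[F]_(1, 3 + 3) :=
  row_mx (P *m gring_eval a (fox alpha (meridian r s))) (P *m gring_eval a (fox beta
    (meridian r s))).
Definition torus_chain : 'M[F]_(1, 3) := P *m gring_eval a (boundary_torus r s).

Lemma gring_eval_boundary : gring_eval a (boundary_torus r s) = a alpha ^ (- r) - word_eval a
  (meridian r s).
Proof. by rewrite /gring_eval !big_cons big_nil /= word_eval_wpow addr0 mulr1z mulrN1z. Qed.

Lemma word_eval_meridian : word_eval a (meridian r s) = a alpha ^ (- r) * a beta ^ s.
Proof. by rewrite word_eval_cat !word_eval_wpow. Qed.

(** The meridian fixes [P], so it acts as 1 in alpha^-r - mu. *)
Lemma torus_chainE : torus_chain = P *m (a alpha ^ (- r) - 1%:M).
Proof. by rewrite /torus_chain gring_eval_boundary mulmxBr mP mulmxBr mulmx1. Qed.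

Lemma gring_eval_fox_relator_alpha :
  gring_eval a (fox alpha (relator p q)) = gring_eval a (fox alpha (wpow alpha p)).
Proof. by rewrite gring_eval_fox_cat (@fox_wpow_neq alpha beta) // gring_eval_nil mulr0
  addr0. Qed.

Lemma gring_eval_fox_relator_beta :
  gring_eval a (fox beta (relator p q)) = gring_eval a (fox beta (wpow beta (- q%:Z))).
Proof.
rewrite gring_eval_fox_cat (@fox_wpow_neq beta alpha) // gring_eval_nil add0r word_eval_wpow.
by rewrite -exprnP aP mul1r.
Qed.

(** The chain equals both P (alpha^-r - 1) and - P alpha^-r (beta^s - 1); the first form kills the
    alpha component of [fox_d2], the second the beta component. Indeed x^m - 1 is a multiple of x -
    1, and x - 1 times the Fox derivative of x^n is x^n - 1 = 0. *)
Lemma torus_chain_d2 : torus_chain *m fox_d2 = 0.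
Proof.
have cA x n : a x ^ n = 1 -> forall m, (a x ^ m - 1%:M) *m gring_eval a (fox x (wpow x n)) = 0.
  move=> an m; rewrite -[a x ^ m - _](gring_eval_fox_wpow a_unit) -[LHS]mulrA.
  have -> : (a x - 1) * gring_eval a (fox x (wpow x n)) = gring_eval a (fox x (wpow x n)) *
    (a x - 1).
    by rewrite mulrBl mulrBr mul1r mulr1 gring_eval_fox_wpow_comm.
  by rewrite gring_eval_fox_wpow // an subrr mulr0.
rewrite /fox_d2 mul_mx_row gring_eval_fox_relator_alpha gring_eval_fox_relator_beta -row_mx0;
  congr row_mx.
  by rewrite torus_chainE -mulmxA cA ?mulmx0.
have -> : torus_chain = - (P *m a alpha ^ (- r) *m (a beta ^ s - 1%:M)).
  by rewrite /torus_chain gring_eval_boundary word_eval_meridian -mulmxE -mulmxA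
    -[RHS]mulmxN; congr (P *m _); rewrite mulmxBr mulmx1 opprB.
rewrite mulNmx -!mulmxA cA ?mulmx0 ?oppr0 //.
by rewrite -invr_expz -exprnP bQ invr1.
Qed.

Lemma fox_d2_d1 : fox_d2 *m fox_d1 = 0.
Proof.
rewrite /fox_d2 /fox_d1 mul_row_col !mulmxE (fox_fundamental a_unit) /relator word_eval_cat
  !word_eval_wpow.
by rewrite -invr_expz -!exprnP aP bQ invr1 mulr1 subrr.
Qed.

Lemma meridian_chain_d1 : meridian_chain *m fox_d1 = 0.
Proof.
rewrite /meridian_chain /fox_d1 mul_row_col -!mulmxA -mulmxDr !mulmxE (fox_fundamental a_unit).
by rewrite mulmxBr mP mulmx1 subrr.
Qed.

(** A cochain that is principal on alpha and zero on beta. Fox derivatives of powers of alpha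
    telescope against [a alpha - 1], which gives the two conditions on [theta] in [is_torsionP]. *)
Definition theta_mx (xi : 'M[F]_(3, 1)) : 'M[F]_(3 + 3, 1) :=
  col_mx ((a alpha - 1%:M) *m xi) 0.

Lemma fox_d2_theta xi : fox_d2 *m theta_mx xi = 0.
Proof.
rewrite /fox_d2 /theta_mx mul_row_col mulmx0 addr0 mulmxA mulmxE gring_eval_fox_relator_alpha.
by rewrite gring_eval_fox_wpow // -exprnP aP subrr mul0mx.
Qed.

Lemma meridian_chain_theta xi : meridian_chain *m theta_mx xi = torus_chain *m xi.
Proof.
rewrite /meridian_chain /theta_mx mul_row_col mulmx0 addr0 -mulmxA [_ *m (_ *m xi)]mulmxA
  mulmxE.
rewrite gring_eval_fox_cat (@fox_wpow_neq alpha beta) // gring_eval_nil mulr0 addr0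
  gring_eval_fox_wpow //.
by rewrite torus_chainE mulmxA.
Qed.

(* Subtracting X times the first columns clears the upper right block of the
   matrix J of is_torsionP. *)
Lemma fox_torsionP (U W K : 'M[F]_3) (xi : 'M[F]_(3, 1)) (X : 'M[F]_3) t
    (Uv := lsubmx (U : 'M_(3, 2 + 1))) (Wv := lsubmx (W : 'M_(3, 2 + 1))) :
  (U : 'M_(3, 2 + 1)) = row_mx Uv ((a alpha - 1%:M) *m xi) ->
  (W : 'M_(3, 2 + 1)) = row_mx Wv 0 ->
  (K : 'M_(3, 1 + 2)) = row_mx xi (fox_d2 *m col_mx Uv Wv) ->
  U *m X = a alpha - 1%:M ->
  torus_chain *m xi != 0 -> \det K != 0 -> \det U != 0 ->
  \det (a beta - 1%:M - W *m X) != 0 ->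
  @is_torsion F 3 2 0 1 1 fox_d1 fox_d2 0 meridian_chain torus_chain t <->
  t = - (\det K / (\det U * \det (a beta - 1%:M - W *m X))).
Proof.
move=> EU EW EK EX h2xi K0 U0 S0.
(* The columns are regrouped: [U] and [W] are the alpha and beta rows of the columns of psi and
   theta together. *)
have JE : row_mx (col_mx Uv Wv) (row_mx (theta_mx xi) fox_d1) =
          block_mx (U : 'M_(3, 2 + 1)) (a alpha - 1%:M) (W : 'M_(3, 2 + 1)) (a beta - 1%:M)
            :> 'M_(2 + 1 + 3).
  have L (Y1 Y2 : 'M[F]_(3, 2)) (Z1 Z2 : 'M[F]_(3, 1)) (D1 D2 : 'M[F]_3) :
      row_mx (col_mx Y1 Y2) (row_mx (col_mx Z1 Z2) (col_mx D1 D2)) =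
      block_mx (row_mx Y1 Z1) D1 (row_mx Y2 Z2) D2 :> 'M_(2 + 1 + 3).
    by rewrite row_mxA castmx_id -block_mxEh block_mxEv -block_mxEh.
  by rewrite /theta_mx /fox_d1 L -EU -EW.
have JX : block_mx (U : 'M_(3, 2 + 1)) (a alpha - 1%:M) (W : 'M_(3, 2 + 1)) (a beta - 1%:M) *m
    block_mx 1%:M (- X : 'M_(2 + 1, 3)) 0 1%:M =
    block_mx (U : 'M_(3, 2 + 1)) 0 (W : 'M_(3, 2 + 1)) (a beta - 1%:M - W *m X).
  rewrite mulmx_block !mulmx1 !mulmx0 !addr0 !mulmxN EX addNr.
  by rewrite [- _ + _]addrC.
have JD : \det (row_mx (col_mx Uv Wv) (row_mx (theta_mx xi) fox_d1) : 'M_6) =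
    \det U * \det (a beta - 1%:M - W *m X).
  have := congr1 determinant JX; rewrite det_mulmx det_ublock !det1 !mulr1 det_lblock => <-.
  by rewrite JE.
rewrite -JD EK.
apply: is_torsionP => //.
- exact: fox_d2_d1.
- exact: meridian_chain_d1.
- exact: torus_chain_d2.
- exact: fox_d2_theta.
- exact: meridian_chain_theta.
- by rewrite JD mulf_neq0.
- by rewrite -EK.
Qed.

End Complex.

(** * The torsion of the normal form *)

Section NormalForm.
Variables (F : numFieldType).
Implicit Types u v e : F.

Definition diag2 u : 'M[F]_2 := mx2 u 0 0 u^-1.

(* v E + v^-1 (1 - E), for the rank one idempotent E = (e, 1; e (1 - e), 1 - e). *)
Definition nf2 v e : 'M[F]_2 :=
  mx2 (v * e + v^-1 * (1 - e)) (v - v^-1)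
      ((v - v^-1) * (e * (1 - e))) (v * (1 - e) + v^-1 * e).

Lemma diag2_det u : u != 0 -> \det (diag2 u) = 1.
Proof. by move=> u0; rewrite det_mx2 !mxE /= mulr0 subr0 mulfV. Qed.

Lemma nf2_det v e : v != 0 -> \det (nf2 v e) = 1.
Proof. by move=> v0; rewrite det_mx2 !mxE /=; field. Qed.

Lemma diag2M u u' : diag2 u * diag2 u' = diag2 (u * u').
Proof. by rewrite mulmx2 /diag2 !mulr0 !mul0r !addr0 !add0r invfM. Qed.

(** [E] is idempotent, so the scalars multiply separately on its image and on its kernel. *)
Lemma nf2M v v' e : v != 0 -> v' != 0 -> nf2 v e * nf2 v' e = nf2 (v * v') e.
Proof.
by move=> v0 v0'; rewrite mulmx2 /nf2 invfM; apply: mx2P; rewrite !mxE /=; field;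
  rewrite ?v0 ?v0'.
Qed.

Lemma diag21 : diag2 1 = 1.
Proof. by apply: mx2P; rewrite !mxE /= ?invr1. Qed.

Lemma nf21 e : nf2 1 e = 1.
Proof. by apply: mx2P; rewrite !mxE /= invr1; ring. Qed.

Lemma morph_exprz (f : F -> 'M[F]_2) :
  f 1 = 1 -> (forall x y, x != 0 -> y != 0 -> f x * f y = f (x * y)) ->
  forall x (n : int), x != 0 -> f x ^ n = f (x ^ n).
Proof.
move=> f1 fM x n x0.
have E k y : y != 0 -> f y ^+ k = f (y ^+ k).
  move=> y0; elim: k => [|k IH]; first by rewrite !expr0.
  by rewrite !exprS IH fM // expf_neq0.
have fV y : y != 0 -> f y^-1 = (f y)^-1.
  move=> y0; have yu : f y \is a GRing.unit.
    by apply/unitrP; exists (f y^-1); rewrite !fM ?invr_eq0 // mulVf // mulfV.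
  by apply: (mulrI yu); rewrite divrr // fM ?invr_eq0 // mulfV.
by case: n => n; [exact: E|rewrite !NegzE -!invr_expz fV ?expfz_neq0 // -!exprnP E].
Qed.

Lemma diag2X u (n : int) : u != 0 -> diag2 u ^ n = diag2 (u ^ n).
Proof. by apply: morph_exprz => [|x y _ _]; [exact: diag21|exact: diag2M]. Qed.

Lemma nf2X v e (n : int) : v != 0 -> nf2 v e ^ n = nf2 (v ^ n) e.
Proof.
by apply: (morph_exprz (f := nf2^~ e)) => [|x y]; [exact: nf21|exact: nf2M].
Qed.

Lemma adj_mx_unit (M : 'M[F]_2) : M \is a GRing.unit -> adj_mx M \is a GRing.unit.
Proof.
by move=> Mu; apply/unitrP; exists (adj_mx M^-1); rewrite -!adj_mxM mulVr ?divrr // adj_mx1.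
Qed.

Lemma adj_mxX (M : 'M[F]_2) (n : int) : M \is a GRing.unit -> adj_mx (M ^ n) = adj_mx M ^ n.
Proof.
move=> Mu; have E k : adj_mx (M ^+ k) = adj_mx M ^+ k.
  by elim: k => [|k IH]; rewrite ?expr0 ?adj_mx1 // !exprS adj_mxM IH.
case: n => n; first exact: E.
rewrite NegzE -!invr_expz -!exprnP -E.
have Mnu : M ^+ n.+1 \is a GRing.unit by rewrite unitrX.
by apply: (mulrI (adj_mx_unit Mnu)); rewrite -adj_mxM !divrr ?adj_mx1 // adj_mx_unit.
Qed.

Lemma chord_sqr u : u != 0 -> chord (u ^+ 2) = - (u - u^-1) ^+ 2.
Proof. by move=> u0; rewrite /chord; field. Qed.

Lemma sum_ord_powers_unity_root (n : nat) (x : F) : x ^+ n = 1 -> x != 1 ->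
  \sum_(k < n) x ^+ k = 0.
Proof.
by move=> xn x1; have := sum_powers_unity_root xn; rewrite (negPf x1) big_mkord.
Qed.

(** The traceless part of [M] commutes with [M], so [adj_mx M - det M] is singular; only the
    cofactor of the upper right entry remains. *)
Lemma det_adj_mx_sub (M : 'M[F]_2) :
  \det (adj_mx M - (\det M)%:M - mx3 0 0 1 0 0 0 0 0 0) = M 0 1 ^+ 2 * \det M *+ 2.
Proof.
rewrite det_mx3 det_mx2 !mxE /=.
by move: (M 0 0) (M 0 1) (M 1 0) (M 1 1) => x y z w; ring.
Qed.

Section Torsion.
Variables (u v e : F) (p q : nat) (r s : int).
Hypotheses (u0 : u != 0) (v0 : v != 0) (p0 : (0 < p)%N) (q0 : (0 < q)%N)
  (up : u ^+ p ^+ 2 = 1) (vq : v ^+ q ^+ 2 = 1) (u1 : u ^+ 2 != 1) (v1 : v ^+ 2 != 1)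
  (ur1 : (u ^ r) ^+ 2 != 1) (vs1 : (v ^ s) ^+ 2 != 1) (e0 : e != 0) (e1 : 1 - e != 0).

Definition nf_ad (x : bool) : 'M[F]_3 := adj_mx (if x == alpha then diag2 u else nf2 v e).

Lemma diag2_unit : diag2 u \is a GRing.unit.
Proof. by rewrite -[_ \is a _]/(_ \in unitmx) unitmxE diag2_det // unitr1. Qed.

Lemma nf2_unit : nf2 v e \is a GRing.unit.
Proof. by rewrite -[_ \is a _]/(_ \in unitmx) unitmxE nf2_det // unitr1. Qed.

Lemma nf_ad_unit x : nf_ad x \is a GRing.unit.
Proof. by apply: adj_mx_unit; case: ifP => _; [exact: diag2_unit|exact: nf2_unit]. Qed.

Lemma nf_ad_alphaX n : nf_ad alpha ^ n = adj_mx (diag2 (u ^ n)).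
Proof. by rewrite /nf_ad eqxx -adj_mxX ?diag2_unit // diag2X. Qed.

Lemma nf_ad_betaX n : nf_ad beta ^ n = adj_mx (nf2 (v ^ n) e).
Proof. by rewrite /nf_ad -adj_mxX ?nf2_unit // nf2X. Qed.

Lemma sqr1_inv x : x ^+ 2 = 1 -> x^-1 = x :> F.
Proof.
move=> /eqP; rewrite sqrf_eq1 => /orP[] /eqP ->; first by rewrite invr1.
by rewrite invrN1.
Qed.

(** [u ^+ p] is a sign, so alpha^p is 1 or -1 and acts trivially. *)
Lemma nf_ad_alphaP : nf_ad alpha ^+ p = 1.
Proof.
rewrite exprnP nf_ad_alphaX -exprnP; apply: mx3P; rewrite !mxE /= ?(sqr1_inv up).
all: try ring.
all: rewrite -[RHS]up; ring.
Qed.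

Lemma nf_ad_betaQ : nf_ad beta ^+ q = 1.
Proof.
rewrite exprnP nf_ad_betaX -exprnP; apply: mx3P; rewrite !mxE /= (sqr1_inv vq).
all: try ring.
all: rewrite -[RHS]vq; ring.
Qed.

Let N := gring_eval nf_ad (fox alpha (wpow alpha p)).
Let D := gring_eval nf_ad (fox beta (wpow beta (- q%:Z))).

(** The adjoint action of alpha is diagonal with eigenvalues u^-2, 1, u^2. The geometric sums of
    length [p] of the outer two vanish, and the eigenvalue 1 gives [p]. *)
Lemma fox_alpha_nfE : N = mx3 0 0 0 0 p%:R 0 0 0 0.
Proof.
rewrite /N gring_eval_fox_nseq /=.
have E k : nf_ad alpha ^+ k = mx3 ((u^-1 ^+ 2) ^+ k) 0 0 0 1 0 0 0 ((u ^+ 2) ^+ k).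
  rewrite [nf_ad alpha ^+ k]exprnP nf_ad_alphaX -exprnP; apply: mx3P; rewrite !mxE /=;
    try ring.
  - by rewrite exprAC exprVn.
  - by rewrite mulfV ?expf_neq0 // mulr0 addr0.
  - by rewrite exprAC.
have S (x : F) : x ^+ 2 != 1 -> x ^+ p ^+ 2 = 1 -> \sum_(k < p) (x ^+ 2) ^+ k = 0.
  by move=> x1 xp; rewrite sum_ord_powers_unity_root // exprAC.
under eq_bigr do rewrite E.
apply: mx3P; rewrite summxE; under eq_bigr do rewrite mxE /=; rewrite mxE /= ?big1_eq //.
- by apply: S; [rewrite exprVn invr_eq1|rewrite !exprVn up invr1].
- by rewrite sumr_const card_ord.
- exact: S.
Qed.

(** The only entry of [D] that the torsion needs. For beta^-k this entry is - (v^k - v^-k)^2 = 2 -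
    v^(2k) - v^(-2k), and the nonconstant terms sum to 0 over 1 <= k <= q. The minus sign is that of
    the Fox derivative of an inverse letter. *)
Lemma fox_beta_nf_entry : D ord_max 0 = - (q%:R *+ 2).
Proof.
(* The sign test in [wpow] computes only once [q] is a successor. *)
rewrite /D gring_eval_fox_nseq; case: q q0 vq => // q' _ vq'; rewrite [`|_|%N]/= [_ < 0]/=.
have S (x : F) : x ^+ 2 != 1 -> x ^+ q'.+1 ^+ 2 = 1 -> \sum_(k < q'.+1) (x ^+ 2) ^+ k.+1 = 0.
  move=> x1 xp; under eq_bigr do rewrite exprS; rewrite -mulr_sumr.
  by rewrite sum_ord_powers_unity_root ?mulr0 // exprAC.
rewrite mxE summxE.
have E (k : 'I_q'.+1) : ((nf_ad beta)^-1 ^+ k.+1) ord_max 0 =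
    2 - (v ^+ 2) ^+ k.+1 - (v^-1 ^+ 2) ^+ k.+1.
  rewrite exprVn [nf_ad beta ^+ _]exprnP invr_expz nf_ad_betaX -invr_expz -exprnP !mxE /=.
  by rewrite -!exprM mulnC !exprM exprVn; have := expf_neq0 k.+1 v0; move: (v ^+ _) => x x0;
    field.
under eq_bigr do rewrite E.
rewrite !sumrB sumr_const card_ord S // S ?subr0; last 2 first.
- by rewrite exprVn invr_eq1.
- by rewrite !exprVn vq' invr1.
by rewrite mulrnAC.
Qed.

Variable P : 'rV[F]_3.
Hypotheses (P0 : P != 0) (mP : P *m word_eval nf_ad (meridian r s) = P).

Definition e_coord : 'M[F]_(3, 1) := \col_i (i == 0)%:R.

Let h2 := torus_chain nf_ad r s P.

Lemma torus_chain_nfE : h2 = \row_j nth 0 [:: P 0 0 * ((u ^ r) ^+ 2 - 1); 0;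
  P 0 ord_max * ((u ^ r)^-1 ^+ 2 - 1)] j.
Proof.
rewrite /h2 torus_chainE // nf_ad_alphaX -invr_expz; apply/rowP; apply: ord3P.
all: rewrite !mxE big_ord3 !mxE /= ?invrK; try ring.
by rewrite mulVf ?expfz_neq0 //; ring.
Qed.

(** The h-coordinate of [h2] is 0. If the e-coordinate vanishes too, then [h2 *m D = 0] and
    [fox_beta_nf_entry] kill the f-coordinate, so [h2 = 0] and alpha^r and beta^s both fix [P]. The
    former makes [P] a multiple of h; the latter then requires the (h, h) entry of the action of
    beta^s to be 1, but with y = v^s it differs from 1 by 2 (y^2 - 1)^2 e (1 - e) / y^2. *)
Lemma torus_chain_e_coord_neq0 : h2 *m e_coord != 0.
Proof.
have E j : (h2 *m e_coord) 0 j = h2 0 0.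
  by rewrite !mxE big_ord3 !mxE /=; ring.
apply/eqP => h0; have h00 : h2 0 0 = 0 by rewrite -(E 0) h0 mxE.
have h01 : h2 0 1 = 0 by rewrite torus_chain_nfE mxE.
have hD : h2 *m D = 0.
  have := torus_chain_d2 nf_ad_unit nf_ad_alphaP nf_ad_betaQ mP.
  rewrite /fox_d2 mul_mx_row (gring_eval_fox_relator_beta _ nf_ad_alphaP) -row_mx0 =>
    /eq_row_mx[_].
  exact.
have h02 : h2 0 ord_max = 0.
  have hD0 : (h2 *m D) 0 0 = 0 by rewrite hD mxE.
  move: hD0; rewrite mxE big_ord3 h00 h01 !mul0r !add0r fox_beta_nf_entry => /eqP.
  rewrite mulf_eq0 oppr_eq0 -[_ *+ 2]mulr_natr -natrM pnatr_eq0 muln_eq0.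
  by rewrite (gtn_eqF q0) /= orbF => /eqP.
have {h00 h01 h02} h20 : h2 = 0 by apply/rowP; apply: ord3P; rewrite [RHS]mxE.
have Px : P *m nf_ad alpha ^ (- r) = P.
  by apply/eqP; rewrite -subr_eq0 -[X in _ - X]mulmx1 -mulmxBr -(torus_chainE mP) -/h2 h20.
have Pe : P *m nf_ad beta ^ s = P.
  by rewrite -{1}Px -mulmxA mulmxE -word_eval_meridian.
have P00 : P 0 0 = 0.
  have := congr1 (fun M : 'rV_3 => M 0 0) h20; rewrite torus_chain_nfE !mxE /= => /eqP.
  by rewrite mulf_eq0 subr_eq0 (negPf ur1) orbF => /eqP.
have P02 : P 0 ord_max = 0.
  have := congr1 (fun M : 'rV_3 => M 0 ord_max) h20; rewrite torus_chain_nfE !mxE /= => /eqP.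
  by rewrite mulf_eq0 subr_eq0 exprVn invr_eq1 (negPf ur1) orbF => /eqP.
have P01 : P 0 1 != 0.
  by apply: contraNneq P0 => P01; apply/eqP/rowP; apply: ord3P; rewrite mxE.
have y0 : v ^ s != 0 by rewrite expfz_neq0.
have := congr1 (fun M : 'rV_3 => M 0 1) Pe.
rewrite nf_ad_betaX mxE big_ord3 P00 P02 !mul0r add0r addr0 -[RHS]mulr1 => /(mulfI P01).
rewrite !mxE /=; move: (v ^ s) y0 vs1 => y y0 y1 /eqP; rewrite -subr_eq0.
have -> : (y * e + y^-1 * (1 - e)) * (y * (1 - e) + y^-1 * e) +
   (y - y^-1) * ((y - y^-1) * (e * (1 - e))) - 1 =
   (y ^+ 2 - 1) ^+ 2 * e * (1 - e) * 2 / y ^+ 2 by field.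
have y2 : y ^+ 2 - 1 != 0 by rewrite subr_eq0.
by apply/negP; rewrite !mulf_neq0 ?invr_eq0 ?expf_neq0 ?pnatr_eq0.
Qed.

Lemma nf_fox_torsionP t :
  @is_torsion F 3 2 0 1 1 (fox_d1 nf_ad) (fox_d2 nf_ad p q) 0 (meridian_chain nf_ad r s P) h2
    t <->
  t = - (p%:R * q%:R / (chord (u ^+ 2) * chord (v ^+ 2))).
Proof.
(* With psi read off from the first two columns of [U] and [W], the matrix [K] is upper triangular
   with diagonal 1, p, -2q, [U] is monomial with determinant [chord (u ^+ 2)], and [W *m X] is the
   elementary matrix of [det_adj_mx_sub]. *)
pose U := mx3 0 0 (u^-1 ^+ 2 - 1) 1 0 0 0 (u ^+ 2 - 1) 0.
pose W : 'M[F]_3 := mx3 0 1 0 0 0 0 0 0 0.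
pose X : 'M[F]_3 := mx3 0 0 0 0 0 1 1 0 0.
pose Uv := lsubmx (U : 'M_(3, 2 + 1)); pose Wv := lsubmx (W : 'M_(3, 2 + 1)).
pose K : 'M[F]_3 := row_mx e_coord (fox_d2 nf_ad p q *m col_mx Uv Wv).
have aE : nf_ad alpha - 1%:M = mx3 (u^-1 ^+ 2 - 1) 0 0 0 0 0 0 0 (u ^+ 2 - 1).
  apply: mx3P; rewrite !mxE /= ?mulfV //; ring.
have detU : \det U = chord (u ^+ 2).
  by rewrite det_mx3 !mxE /= /chord; field.
have detS : \det (nf_ad beta - 1%:M - W *m X) = - (chord (v ^+ 2) *+ 2).
  have -> : W *m X = mx3 0 0 1 0 0 0 0 0 0.
    by apply: mx3P; rewrite !mxE big_ord3 !mxE /=; ring.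
  have := det_adj_mx_sub (nf2 v e); rewrite nf2_det // => detE.
  by rewrite [LHS]detE !mxE /= /chord; field.
have c1 (x : F) : x != 0 -> x ^+ 2 != 1 -> chord (x ^+ 2) != 0.
  move=> x0 x1; rewrite chord_sqr // oppr_eq0 expf_neq0 // subr_eq0.
  by apply: contraNneq x1 => E; rewrite expr2 {1}E mulVf.
have gE : fox_d2 nf_ad p q *m col_mx Uv Wv = N *m Uv + D *m Wv.
  rewrite /fox_d2 mul_row_col gring_eval_fox_relator_alpha (gring_eval_fox_relator_beta _
    nf_ad_alphaP) //.
have ord1E : (1 : 'I_3) = rshift 1 (0 : 'I_2) by apply: val_inj.
have ord2E : (ord_max : 'I_3) = rshift 1 (1 : 'I_2) by apply: val_inj.
have ord0E : (0 : 'I_3) = lshift 2 (0 : 'I_1) by apply: val_inj.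
have K0 i : K i 0 = (i == 0)%:R.
  by rewrite ord0E [K _ _]row_mxEl mxE ord0E.
have K1 i : K i 1 = if i == 1 then p%:R else 0.
  rewrite ord1E [K _ _]row_mxEr gE -ord1E fox_alpha_nfE !mxE !big_ord3 !mxE /=.
  by move: i; apply: ord3P; rewrite /=; ring.
have K2 : K ord_max ord_max = - (q%:R *+ 2).
  rewrite {2}ord2E [K _ _]row_mxEr gE fox_alpha_nfE !mxE !big_ord3 !mxE /= -fox_beta_nf_entry
    ; ring.
have detK : \det K = - (p%:R * q%:R *+ 2).
  by rewrite det_mx3 !K0 !K1 K2 /=; ring.
have p1 : p%:R != 0 :> F by rewrite pnatr_eq0 -lt0n.
have q1 : q%:R != 0 :> F by rewrite pnatr_eq0 -lt0n.
have := @fox_torsionP F nf_ad p q r s P nf_ad_unit nf_ad_alphaP nf_ad_betaQ mP U W K e_coord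
  X t.
rewrite detU detS detK.
have -> : - (- (p%:R * q%:R *+ 2) / (chord (u ^+ 2) * - (chord (v ^+ 2) *+ 2))) =
  - (p%:R * q%:R / (chord (u ^+ 2) * chord (v ^+ 2))).
  by field; rewrite !c1.
apply.
- apply: (eq_trans (esym (@hsubmxK _ 3 2 1 U))); congr row_mx; apply/colP.
  by apply: ord3P; rewrite aE !mxE ?big_ord3 ?mxE /=; ring.
- apply: (eq_trans (esym (@hsubmxK _ 3 2 1 W))); congr row_mx; apply/colP.
  by apply: ord3P; rewrite !mxE.
- by [].
- by rewrite aE; apply: mx3P; rewrite !mxE !big_ord3 !mxE /=; ring.
- exact: torus_chain_e_coord_neq0.
- by rewrite oppr_eq0 mulrn_eq0 /= mulf_neq0.
- exact: c1.
- by rewrite oppr_eq0 mulrn_eq0 /= c1.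
Qed.

End Torsion.
End NormalForm.

(** * Sign and conjugation *)

(** [M] commutes with its traceless part, taken twice to avoid division; if that part is 0 then [M]
    is scalar and h serves. *)
Lemma adj_mx_fixed (F : numFieldType) (M : 'M[F]_2) : \det M = 1 ->
  exists2 P : 'rV[F]_3, P != 0 & P *m adj_mx M = P.
Proof.
rewrite det_mx2 => dM.
pose P : 'rV[F]_3 := \row_j nth 0 [:: 2 * M 0 1; M 0 0 - M 1 1; 2 * M 1 0] j.
have [P0|P0] := eqVneq P 0; last first.
  exists P => //; apply/rowP; apply: ord3P; rewrite mxE big_ord3 !mxE /=;
  move: (M 0 0) (M 0 1) (M 1 0) (M 1 1) dM => x y z w dM;
  rewrite -[RHS]mul1r -[X in _ = X * _]dM; ring.
have n2 : 2 != 0 :> F by rewrite pnatr_eq0.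
have y0 : M 0 1 = 0.
  have := congr1 (fun P : 'rV_3 => P 0 0) P0; rewrite !mxE /= => /eqP.
  by rewrite mulf_eq0 (negPf n2) => /eqP.
have z0 : M 1 0 = 0.
  have := congr1 (fun P : 'rV_3 => P 0 ord_max) P0; rewrite !mxE /= => /eqP.
  by rewrite mulf_eq0 (negPf n2) => /eqP.
have xw : M 0 0 = M 1 1.
  have := congr1 (fun P : 'rV_3 => P 0 1) P0; rewrite !mxE /= => /eqP.
  by rewrite subr_eq0 => /eqP.
exists (\row_j (j == 1)%:R).
  apply/eqP => /rowP /(_ 1); rewrite !mxE /= => /eqP; by rewrite oner_eq0.
apply/rowP; apply: ord3P; rewrite mxE big_ord3 !mxE /= ?y0 ?z0.
- ring.
- by rewrite -[RHS]dM y0; ring.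
- ring.
Qed.

Section RealTorsion.
Variable (R : realType).

Lemma re_d2E (p q : nat) : re_d2 R p q = row_mx p%:R%:M (- q%:R)%:M.
Proof.
rewrite /re_d2 /relator !fox_cat !aug_cat !aug_shift !aug_fox_wpow.
rewrite (@fox_wpow_neq alpha beta) // (@fox_wpow_neq beta alpha) //.
by rewrite /aug !big_nil addr0 add0r rmorphN.
Qed.

Lemma re_h1E (r s : int) : re_h1 R r s = row_mx (- r%:~R)%:M s%:~R%:M.
Proof.
rewrite /re_h1 /meridian !fox_cat !aug_cat !aug_shift !aug_fox_wpow.
rewrite (@fox_wpow_neq alpha beta) // (@fox_wpow_neq beta alpha) //.
by rewrite /aug !big_nil addr0 add0r rmorphN.
Qed.

Lemma det_col_mx_emptyl (n : nat) (X : 'M[R]_(n.+1, 0 + n.+1)) (Y : 'M[R]_(0, 0 + n.+1)) :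
  \det (col_mx Y X) = \det (X : 'M_n.+1).
Proof.
congr (\det _); apply/matrixP => i j.
by rewrite -[RHS](col_mxEd Y X); congr (col_mx Y X _ _); exact: val_inj.
Qed.

Lemma row_col_mx_emptyr (n : nat) (X : 'M[R]_(1, n)) (Y : 'M[R]_(0, n)) :
  col_mx X Y = X :> 'M_(1, n).
Proof.
apply/matrixP => i j.
by rewrite -[RHS](col_mxEu X Y); congr (col_mx X Y _ _); exact: val_inj.
Qed.

(** The rows (p, -q) and (-r, s) have determinant p s - q r = 1 and the scalar [b2] cancels. The
    sign exponent is 1 * 1 + 3 * 2 + 4 * 2 = 15, so the value is -1; it compensates the minus sign
    of the twisted torsion. *)
Lemma real_torsionP (p q : nat) (r s : int) (t : R) :
  p%:Z * s - q%:Z * r = 1 -> is_real_torsion p q r s t <-> t = -1.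
Proof.
move=> hrs.
have pqrs : p%:R * s%:~R - q%:R * r%:~R = 1 :> R.
  have := congr1 (fun n : int => n%:~R : R) hrs.
  by rewrite /= rmorphB !rmorphM /=.
have eval (b1 : 'M[R]_(0, 1 + (1 + 0))) (b2 : 'M[R]_(1, 0 + 1)) : (b2 : 'M_1) 0 0 != 0 ->
    (-1) ^+ torsion_sign 0 1 1 1 0 *
      ((\det (col_mx (b1 *m (0 : 'M_(1 + (1 + 0), 0 + 1))) (1%:M : 'M_(1, 0 + 1))))^-1 *
       \det (col_mx (b2 *m (re_d2 R p q : 'M_(0 + 1, 1 + (1 + 0)))) (col_mx (re_h1 R r s)
         b1)) *
       (\det (col_mx (0 : 'M_(0, 0 + 1)) b2))^-1) = -1.
  move=> b0.
  rewrite det_col_mx_emptyl det_col_mx_emptyl (row_col_mx_emptyr (re_h1 R r s) b1) det1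
    det_mx11.
  have b2E : b2 = (b2 0 0)%:M :> 'M_1 by rewrite [LHS]mx11_scalar.
  rewrite [X in X *m _]b2E mul_scalar_mx re_d2E re_h1E scale_row_mx.
  set M := col_mx _ _.
  have -> : \det M = b2 0 0.
    rewrite /M -block_mxEv det_mx2.
    have e0 : (0 : 'I_2) = lshift 1 (0 : 'I_1) by apply: val_inj.
    have e1 : (1 : 'I_2) = rshift 1 (0 : 'I_1) by apply: val_inj.
    rewrite e0 e1 (@block_mxEul _ 1 1 1 1) (@block_mxEur _ 1 1 1 1) (@block_mxEdl _ 1 1 1 1).
    rewrite (@block_mxEdr _ 1 1 1 1) !mxE /=.
    by rewrite -[RHS]mulr1 -[X in _ = _ * X]pqrs ?mulr1n; ring.
  by rewrite invr1 mul1r divff // /torsion_sign -signr_odd /= expr1 mulr1.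
have rf (b1 : 'M[R]_(0, 1 + (1 + 0))) : row_free (b1 *m (0 : 'M_(1 + (1 + 0), 0 + 1))) /\
    (b1 *m (0 : 'M_(1 + (1 + 0), 0 + 1)) == (0 : 'M_(1 + (1 + 0), 0 + 1)))%MS.
  by rewrite mulmx0 /row_free mxrank0 !sub0mx.
have d2n0 : re_d2 R p q != 0.
  apply/eqP; rewrite re_d2E -row_mx0 => /eq_row_mx[/matrixP/(_ 0 0) p0 /matrixP/(_ 0 0) q0].
  move: pqrs p0 q0; rewrite !mxE /= !mulr1n => + p0 /eqP; rewrite oppr_eq0 => + /eqP q0.
  by rewrite p0 q0 !mul0r subrr => /esym/eqP; rewrite oner_eq0.
split=> [[b1 [b2 [_ [f2 _] ->]]]|->].
  apply: eval; apply: contraTneq f2 => b0.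
  rewrite (_ : b2 = 0) ?mul0mx /row_free ?mxrank0 //.
  by apply/matrixP => i j; rewrite [RHS]mxE (ord1 i) -b0; congr (b2 _ _); apply: val_inj;
    case: j => [[]].
exists 0, (1%:M : 'M_1); split; [exact: rf| |rewrite eval // mxE oner_eq0 //].
rewrite mul1mx; split; last by rewrite !submx_refl.
by rewrite /row_free rank_rV d2n0.
Qed.

End RealTorsion.

Lemma word_eval_conj (T : unitRingType) (a a' : bool -> T) (G : T) :
  G \is a GRing.unit -> (forall x, a x \is a GRing.unit) ->
  (forall x, a' x = G^-1 * a x * G) -> forall w, word_eval a' w = G^-1 * word_eval a w * G.
Proof.
move=> Gu a_unit a'E; elim=> [|[x b] w IH]; first by rewrite /word_eval !big_nil mulr1 mulVr.
rewrite -cat1s !word_eval_cat IH !wev1 /= a'E; case: b.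
  have GaV : G^-1 * a x \is a GRing.unit by rewrite unitrMl ?unitrV.
  by rewrite (invrM GaV Gu) (invrM _ (a_unit x)) ?unitrV // invrK !mulrA mulrK.
by rewrite !mulrA mulrK.
Qed.

Section Conjugation.
Variables (F : fieldType) (a a' : bool -> 'M[F]_3) (G : 'M[F]_3).
Hypotheses (Gu : G \in unitmx) (a_unit : forall x, a x \is a GRing.unit)
  (a'E : forall x, a' x = G^-1 * a x * G).

Lemma gring_eval_conj z : gring_eval a' z = invmx G *m gring_eval a z *m G.
Proof.
rewrite !mulmxE /gring_eval mulr_sumr mulr_suml; apply: eq_bigr => t _.
by rewrite (word_eval_conj _ a_unit a'E) // mulrzAr mulrzAl.
Qed.

(** Conjugation changes the bases by [G] on each copy of sl_2. The middle term has two copies and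
    the outer terms one each, so the determinants cancel. *)
Lemma fox_torsion_conj (p q : nat) (r s : int) (P : 'rV[F]_3) t :
  @is_torsion F 3 2 0 1 1 (fox_d1 a) (fox_d2 a p q) 0 (meridian_chain a r s P) (torus_chain a
    r s P) t ->
  @is_torsion F 3 2 0 1 1 (fox_d1 a') (fox_d2 a' p q) 0 (meridian_chain a' r s (P *m G))
    (torus_chain a' r s (P *m G)) t.
Proof.
pose GG : 'M[F]_(3 + 3) := block_mx G 0 0 G.
have dG : \det GG = \det G * \det G by rewrite det_ublock.
have dG0 : \det G != 0 by rewrite -unitfE -unitmxE.
have GGu : GG \in unitmx by rewrite unitmxE dG unitrM -unitmxE Gu.
have GGV : invmx GG = block_mx (invmx G) 0 0 (invmx G).
  rewrite -[RHS](mulKmx GGu) mulmx_block !mulmx0 !mul0mx !addr0 !add0r !mulmxV //.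
  by rewrite -scalar_mx_block mulmx1.
move=> /(@is_torsion_change_basis F 3 2 0 1 1 _ _ _ _ _ G GG G _ Gu GGu Gu).
rewrite dG divff ?mulf_neq0 // mul1r mul0mx.
have -> : fox_d1 a' = invmx GG *m fox_d1 a *m G.
  rewrite GGV /fox_d1 mul_block_col !mul0mx addr0 add0r mul_col_mx !a'E -!mulmxE.
  by rewrite !mulmxBr !mulmxBl !mulmx1 mulVmx.
have -> : fox_d2 a' p q = invmx G *m fox_d2 a p q *m GG.
  by rewrite /fox_d2 mul_mx_row mul_row_block !mulmx0 addr0 add0r !gring_eval_conj.
have -> : meridian_chain a' r s (P *m G) = meridian_chain a r s P *m GG.
  rewrite /meridian_chain mul_row_block !mulmx0 addr0 add0r !gring_eval_conj.
  by rewrite !mulmxA !mulmxK.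
have -> : torus_chain a' r s (P *m G) = torus_chain a r s P *m G.
  by rewrite /torus_chain gring_eval_conj !mulmxA mulmxK.
exact.
Qed.

End Conjugation.

Section AdjointTorsion.
Variables (R : realType) (p q : nat) (r s : int).
Hypothesis (hrs : p%:Z * s - q%:Z * r = 1).
Implicit Types rho : rep R.

(** The sign of the real torsion is always -1, which appears here as [- T]. *)
Lemma is_adjoint_torsionE rho T : \det rho.1 = 1 -> \det rho.2 = 1 ->
  let a := ad_gen rho in
  is_adjoint_torsion p q r s rho T <->
  exists2 P : 'rV[R[i]]_3, P != 0 &
    [/\ P *m word_eval a (meridian r s) = P, P *m word_eval a (fibre p) = P &
      @is_torsion R[i] 3 2 0 1 1 (fox_d1 a) (fox_d2 a p q) 0 (meridian_chain a r s P)
        (torus_chain a r s P) (- T)].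
Proof.
move=> dA dB a.
have d1E : tw_d1 rho = fox_d1 a.
  rewrite /tw_d1 /fox_d1 !act_gring_eval // -/a.
  have E x : gring_eval a [:: (1, [:: (x, false)]); (-1, [::])] = a x - 1%:M.
    by rewrite /gring_eval big_cons big_seq1 /= wev1 /word_eval big_nil.
  by rewrite !E.
have d2E : tw_d2 p q rho = fox_d2 a p q by rewrite /tw_d2 /fox_d2 !act_gring_eval.
have h1E P : tw_h1 r s rho P = meridian_chain a r s P by rewrite /tw_h1 /meridian_chain
  !act_gring_eval.
have h2E P : tw_h2 r s rho P = torus_chain a r s P by rewrite /tw_h2 /torus_chain
  !act_gring_eval.
split.
  case=> P [t0 [t [P0 [Pm Pf] tR tt TE]]].
  have t0E := iffLR (real_torsionP t0 hrs) tR.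
  have tE : - T = t by rewrite TE t0E sgrN sgr1 rmorphN rmorph1 mulN1r opprK.
  exists P; [exact: P0|split].
  - by rewrite /a -(ad_inv_ev dA dB).
  - by rewrite /a -(ad_inv_ev dA dB).
  - by rewrite tE -d1E -d2E -h1E -h2E.
case=> P P0 [Pm Pf tt]; exists P, (-1), (- T); split.
- exact: P0.
- by split; rewrite (ad_inv_ev dA dB).
- exact: (iffRL (real_torsionP _ hrs)).
- by rewrite d1E d2E h1E h2E.
- by rewrite sgrN sgr1 rmorphN rmorph1 mulrNN mul1r.
Qed.

End AdjointTorsion.

Section ConjRep.
Variables (R : realType) (p q : nat) (r s : int).
Hypothesis (hrs : p%:Z * s - q%:Z * r = 1).
Implicit Types rho : rep R.

Lemma conj_rep_refl rho : conj_rep rho rho.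
Proof. by exists 1; rewrite ?det1 // invr1 !mul1r !mulr1; case: rho. Qed.

Lemma conj_rep_sym rho rho' : conj_rep rho rho' -> conj_rep rho' rho.
Proof.
case=> S dS ->; have Su := unit_det1 dS.
exists S^-1; first by rewrite -[_^-1]/(invmx _) det_inv dS invr1.
by rewrite invrK /= !mulrA !mulVr // !mul1r !mulrVK //; case: rho.
Qed.

Lemma conj_rep_trans rho1 rho2 rho3 :
  conj_rep rho1 rho2 -> conj_rep rho2 rho3 -> conj_rep rho1 rho3.
Proof.
case=> S dS -> [S' dS' ->]; exists (S' * S); first by rewrite -mulmxE det_mulmx dS dS' mulr1.
by rewrite invrM ?unit_det1 //= !mulrA.
Qed.

Lemma conj_class_eq rho rho' : conj_rep rho rho' -> conj_class rho = conj_class rho'.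
Proof.
move=> h; apply/seteqP; split=> x /=; last exact: conj_rep_trans.
by apply: conj_rep_trans; apply: conj_rep_sym.
Qed.

Lemma det_conj (S M : 'M[R[i]]_2) : \det S = 1 -> \det (S * M * S^-1) = \det M.
Proof.
move=> dS; rewrite -!mulmxE !det_mulmx dS mul1r.
by rewrite -[_^-1]/(invmx _) det_inv dS invr1 mulr1.
Qed.

Lemma det_ev rho w : \det rho.1 = 1 -> \det rho.2 = 1 -> \det (ev rho w) = 1.
Proof.
move=> dA dB; elim: w => [|[x b] w IH]; first by rewrite /ev big_nil det1.
rewrite /ev big_cons -/(ev rho w) -mulmxE det_mulmx IH mulr1.
have dM : \det (if x == alpha then rho.1 else rho.2) = 1 by case: ifP.
by case: b; rewrite /= ?dM // -[_^-1]/(invmx _) det_inv dM invr1.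
Qed.

Lemma ev_conj (S : 'M[R[i]]_2) rho w : \det S = 1 ->
  \det rho.1 = 1 -> \det rho.2 = 1 ->
  ev (S * rho.1 * S^-1, S * rho.2 * S^-1) w = S * ev rho w * S^-1.
Proof.
move=> dS dA dB; have SVu : S^-1 \is a GRing.unit by rewrite unitrV unit_det1.
rewrite ev_word_eval (word_eval_conj SVu (gen_unit dA dB)) ?invrK // => x.
by rewrite /gen; case: ifP.
Qed.

Lemma is_adjoint_torsion_conj rho rho' T : \det rho.1 = 1 -> \det rho.2 = 1 ->
  conj_rep rho rho' -> is_adjoint_torsion p q r s rho T -> is_adjoint_torsion p q r s rho' T.
Proof.
move=> dA dB [S dS ->]; have Su := unit_det1 dS.
move=> /(iffLR (is_adjoint_torsionE hrs T dA dB)) [P P0 [Pm Pf tt]].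
apply: (iffRL (is_adjoint_torsionE hrs _ _ _)); [by rewrite det_conj|by rewrite det_conj|].
have SVu : S^-1 \is a GRing.unit by rewrite unitrV.
pose G : 'M_3 := ad_inv S^-1.
have Gu : G \is a GRing.unit by exact: ad_inv_unit.
have GE : G^-1 = ad_inv S by rewrite /G ad_invV // invrK.
have gu x := gen_unit dA dB x.
have aE x : ad_gen (S * rho.1 * S^-1, S * rho.2 * S^-1) x = G^-1 * ad_gen rho x * G.
  rewrite GE /ad_gen (_ : gen _ x = S * gen rho x * S^-1); last by rewrite /gen; case: ifP.
  by rewrite -!ad_invM // unitrMl // gu.
have au := ad_gen_unit dA dB.
exists (P *m G); first by rewrite mulmx_free_eq0 // row_free_unit.
have W w : P *m word_eval (ad_gen rho) w = P ->
    P *m G *m word_eval (ad_gen (S * rho.1 * S^-1, S * rho.2 * S^-1)) w = P *m G.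
  move=> Pw; rewrite (word_eval_conj Gu au aE) -!mulmxE !mulmxA.
  by rewrite -[P *m G *m _]mulmxA mulmxE divrr // mulmx1 Pw.
split; [exact: W|exact: W|].
exact: (fox_torsion_conj Gu au aE).
Qed.

(** [nf_fox_torsionP] gives the same value for every admissible [P]. The converse also requires one
    such [P]: a vector fixed by the meridian, which the fibre fixes as well because it acts
    trivially. *)
Lemma nf_adjoint_torsionP (u v e : R[i]) T : (0 < p)%N -> (0 < q)%N ->
  u != 0 -> v != 0 -> u ^+ p ^+ 2 = 1 -> v ^+ q ^+ 2 = 1 -> u ^+ 2 != 1 -> v ^+ 2 != 1 ->
  (u ^ r) ^+ 2 != 1 -> (v ^ s) ^+ 2 != 1 -> e != 0 -> 1 - e != 0 ->
  is_adjoint_torsion p q r s (diag2 u, nf2 v e) T <->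
  T = p%:R * q%:R / (chord (u ^+ 2) * chord (v ^+ 2)).
Proof.
move=> p0 q0 u0 v0 up vq u1 v1 ur1 vs1 e0 e1.
have dA := diag2_det u0; have dB := nf2_det e v0.
have aE : ad_gen (diag2 u, nf2 v e) = nf_ad u v e.
  by apply/funext => x; rewrite /ad_gen /nf_ad /gen /=; case: ifP => _; rewrite ad_inv_adj_mx.
have tE P (P0 : P != 0) (mP : P *m word_eval (nf_ad u v e) (meridian r s) = P) :=
  nf_fox_torsionP u0 v0 p0 q0 up vq u1 v1 ur1 vs1 e0 e1 P0 mP.
have tP T' := @is_adjoint_torsionE R p q r s hrs (diag2 u, nf2 v e) T' dA dB.
rewrite aE in tP; split=> [/(iffLR (tP T))|->].
  move=> -[P P0 [Pm _ tt]]; exact/oppr_inj/(iffLR (tE P P0 Pm _) tt).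
apply: (iffRL (tP _)).
have dm : \det (ev (diag2 u, nf2 v e) (meridian r s)) = 1.
  exact: det_ev.
have [P P0] := adj_mx_fixed dm.
rewrite -ad_inv_adj_mx // ad_inv_ev // aE => Pm.
exists P; [exact: P0|split; first exact: Pm].
  have aP : nf_ad u v e alpha ^+ p = 1 by exact: nf_ad_alphaP.
  by rewrite /fibre word_eval_wpow -exprnP aP mulmx1.
exact: (iffRL (tE P P0 Pm _)).
Qed.

(** By invariance under conjugation the set under [xget] has the single element [T], so the default
    value 0 does not interfere. *)
Lemma adjoint_torsion_conj_class rho (T : R[i]) : \det rho.1 = 1 -> \det rho.2 = 1 ->
  (forall T', is_adjoint_torsion p q r s rho T' <-> T' = T) ->
  adjoint_torsion p q r s (conj_class rho) = T.
Proof.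
move=> dA dB TP; rewrite /adjoint_torsion.
apply: xget_unique => [|T' [rho' h]]; first by exists rho; [exact: conj_rep_refl|exact/TP].
move=> T'P; apply/TP; apply: is_adjoint_torsion_conj (conj_rep_sym h) T'P.
all: by case: h => S dS -> /=; rewrite det_conj.
Qed.

End ConjRep.

(** * Normal form of irreducible representations *)

Section Closed.
Variable F : numClosedFieldType.
Implicit Types M S : 'M[F]_2.

Lemma diag2_scalar u : u ^+ 2 = 1 -> diag2 u = u%:M :> 'M[F]_2.
Proof. by move=> u2; apply: mx2P; rewrite !mxE //=; apply: sqr1_inv. Qed.

(** The minimal polynomial divides X^m - 1, which has distinct roots, so [M] is diagonalisable. An
    eigenvalue of square 1 would equal its inverse and make [M] scalar. *)
Lemma diag2_conj (m : nat) (z : F) M : m.-primitive_root z ->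
  M ^+ m = 1 -> \det M = 1 -> (forall c, M != c%:M) ->
  exists S (i : 'I_m), [/\ \det S = 1, S * M * S^-1 = diag2 (z ^+ i) & (z ^+ i) ^+ 2 != 1].
Proof.
move=> zP Mm dM Mns; have m0 := prim_order_gt0 zP.
have [P Pu] : exists2 P, P \in unitmx & mxpoly.diagonalizable_for P M.
  apply/mxpoly.diagonalizableP; exists [seq z ^+ i | i <- index_iota 0 m].
    rewrite map_inj_in_uniq ?iota_uniq // => i j; rewrite !mem_index_iota /= => im jm.
    by move/eqP; rewrite (eq_prim_root_expr zP) /eqn !modn_small // => /eqP.
  rewrite big_map factor_Xn_sub_1 //; apply: mxminpoly_min.
  by rewrite rmorphB rmorphXn /= horner_mx_X rmorph1 Mm subrr.
move=> /(mxpoly.diagonalizable_forP _ Pu) Pdiag.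
have dP0 : \det P != 0 by rewrite -unitfE -unitmxE.
(* In size 2, scaling by a square root of 1 / det P brings the diagonalising matrix into SL_2. *)
pose c := sqrtC (\det P)^-1; pose S := c *: P.
have c2 : c ^+ 2 = (\det P)^-1 by rewrite sqrtCK.
have c0 : c != 0.
  by apply: contra_eq_neq c2 => ->; rewrite expr0n /= eq_sym invr_eq0.
have dS : \det S = 1 by rewrite detZ c2 mulVf.
have Su : S \is a GRing.unit by rewrite -[_ \is a _]/(_ \in unitmx) unitmxE dS unitr1.
have SV : S^-1 = c^-1 *: P^-1.
  have PV : P * P^-1 = 1 by rewrite divrr.
  apply: (mulrI Su); rewrite divrr // /S -scalerAl -scalerAr scalerA PV.
  by rewrite divff // scale1r.
pose D := S * M * S^-1.
have DE : D = P *m M *m invmx P.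
  rewrite /D SV /S -!scalerAl -!scalerAr scalerA divff // scale1r.
  by rewrite -!mulmxE.
have dD : \det D = 1.
  by rewrite /D -!mulmxE !det_mulmx dS dM mul1r -[S^-1]/(invmx S) det_inv dS invr1 mulr1.
have D01 : D 0 1 = 0 by rewrite DE Pdiag.
have D10 : D 1 0 = 0 by rewrite DE Pdiag.
move: (dD); rewrite det_mx2 D01 mul0r subr0 => d01.
have d0 : D 0 0 != 0 by apply: contra_eq_neq d01 => ->; rewrite mul0r eq_sym oner_eq0.
have Dd : D = diag2 (D 0 0).
  rewrite [LHS]mx2_eta D01 D10 /diag2; congr (mx2 _ _ _ _).
  by apply: (mulfI d0); rewrite d01 divff.
have Dm : D ^+ m = 1.
  have -> : D ^+ m = S * M ^+ m * S^-1.
    elim: (m) => [|k IH]; first by rewrite !expr0 mulr1 divrr.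
    by rewrite !exprS IH /D !mulrA mulrVK.
  by rewrite Mm mulr1 divrr.
have d0m : D 0 0 ^+ m = 1.
  move: Dm; rewrite Dd exprnP diag2X // -exprnP => /matrixP/(_ 0 0).
  by rewrite !mxE /=.
have [i dE] := prim_rootP zP d0m.
exists S, i; split => //; rewrite -dE //.
apply/eqP => d2; have := Mns (D 0 0); apply/negP; rewrite negbK; apply/eqP.
have ME : M = S^-1 * D * S by rewrite /D !mulrA mulVr // mul1r mulrVK.
have Ds : D = (D 0 0)%:M by rewrite [LHS]Dd diag2_scalar.
have SC : S^-1 * (D 0 0)%:M = (D 0 0)%:M * S^-1 by rewrite -!mulmxE scalar_mxC.
by rewrite [LHS]ME {1}Ds SC mulrVK.
Qed.

(** The exponents 0 and n give eigenvalues of square 1 and are excluded; the Weyl element [W] swaps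
    the two eigenvalues, which replaces i by 2n - i. *)
Lemma diag2_conj_half (n : nat) (z : F) M : (2 * n).-primitive_root z -> z ^+ n = -1 ->
  M ^+ (2 * n) = 1 -> \det M = 1 -> (forall c, M != c%:M) ->
  exists S (i : nat), [/\ (0 < i < n)%N, \det S = 1 & S * M * S^-1 = diag2 (z ^+ i)].
Proof.
move=> zP zn Mm dM Mns; have z0 := prim_root_neq0 zP.
have [S [[i i2n] /= [dS SE zi]]] := diag2_conj zP Mm dM Mns.
have i0 : i != 0%N by apply: contraNneq zi => ->; rewrite expr0 expr1n.
have i_n : i != n by apply: contraNneq zi => ->; rewrite zn sqrrN expr1n.
have [lt_in|le_ni] := ltnP i n; first by exists S, i; rewrite lt0n i0.
pose W : 'M[F]_2 := mx2 0 1 (-1) 0.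
have dW : \det W = 1 by rewrite det_mx2 !mxE /=; ring.
have Su : S \is a GRing.unit by rewrite -[_ \is a _]/(_ \in unitmx) unitmxE dS unitr1.
have Wu : W \is a GRing.unit by rewrite -[_ \is a _]/(_ \in unitmx) unitmxE dW unitr1.
exists (W * S), (2 * n - i)%N; split; first by lia.
  by rewrite -mulmxE det_mulmx dW dS mulr1.
rewrite invrM // -!mulrA (mulrA S) (mulrA (S * M)) SE mx2_inv //.
rewrite /diag2 !mulmx2 expfB // (prim_expr_order zP) div1r invrK.
by apply: mx2P; rewrite !mxE /=; ring.
Qed.

Lemma mx2_inv_tr M : \det M = 1 -> M^-1 = (\tr M)%:M - M.
Proof.
move=> dM; rewrite mx2_inv // /mxtrace big_ord2.
by apply: mx2P; rewrite !mxE /=; ring.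
Qed.

Lemma rank2_eigenspace M c : \rank (eigenspace M c) = 2%N -> M = c%:M.
Proof.
move=> r2; have /eigenspaceP : (1%:M <= eigenspace M c)%MS.
  by rewrite sub1mx /row_full r2.
by rewrite mul1mx scalemx1.
Qed.

(** Conjugation by [diag2 t] multiplies the upper right entry by t^2, which fixes [t]. The upper
    left entry then determines [e], and the trace and the determinant force the other two
    entries. *)
Lemma nf2_conj (v : F) M : v != 0 -> v ^+ 2 != 1 -> \det M = 1 -> \tr M = v + v^-1 ->
  M 0 1 != 0 ->
  exists t e : F, t != 0 /\ diag2 t * M * (diag2 t)^-1 = nf2 v e.
Proof.
move=> v0 v1 dM trM y0.
have vv : v - v^-1 != 0.
  by rewrite subr_eq0; apply: contraNneq v1 => E; rewrite expr2 {1}E mulVf.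
pose t := sqrtC ((v - v^-1) / M 0 1).
have t2 : t ^+ 2 = (v - v^-1) / M 0 1 by rewrite sqrtCK.
have t0 : t != 0.
  by apply: contra_eq_neq t2 => ->; rewrite expr0n /= eq_sym mulf_neq0 // invr_eq0.
exists t, ((M 0 0 - v^-1) / (v - v^-1)); split => //.
have tV : (diag2 t)^-1 = diag2 t^-1.
  rewrite mx2_inv ?diag2_det //.
  by apply: mx2P; rewrite !mxE /= ?oppr0 ?invrK.
rewrite tV {1}[M]mx2_eta.
move: trM dM y0 t2; rewrite /mxtrace big_ord2 det_mx2.
move: (M 0 0) (M 0 1) (M 1 0) (M 1 1) => x y z w trM dM y0 t2.
set d := v - v^-1 in vv t2 *; set e := (x - v^-1) / d.
have ed : e * d = x - v^-1 by rewrite divfK.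
have wE : w = v + v^-1 - x by rewrite -trM addrAC subrr add0r.
rewrite /diag2 !mulmx2 /nf2 -/d; apply: mx2P; rewrite !mxE /= ?invrK.
- have -> : v * e + v^-1 * (1 - e) = e * d + v^-1 by rewrite /d; ring.
  by rewrite ed subrK; field.
- have -> : (t * x + 0 * z) * 0 + (t * y + 0 * w) * t = t ^+ 2 * y by ring.
  by rewrite t2 divfK.
- have -> : (0 * x + t^-1 * z) * t^-1 + (0 * y + t^-1 * w) * 0 = z / t ^+ 2 by field.
  rewrite t2 invf_div; apply: (mulIf vv).
  have -> : z * (y / d) * d = z * y by rewrite -mulrA divfK.
  have -> : d * (e * (1 - e)) * d = (e * d) * (d - e * d) by ring.
  rewrite ed.
  have -> : z * y = x * w - 1 by rewrite -dM; ring.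
  by rewrite wE /d; field.
- have -> : v * (1 - e) + v^-1 * e = v - e * d by rewrite /d; ring.
  by rewrite ed wE; field; rewrite t0 v0.
Qed.

End Closed.

(** * Points of the unit circle and roots of unity *)

Section Cis.
Variable R : realType.
Implicit Types (x y t : R) (n : nat).

Definition cis x : R[i] := cos x +i* sin x.

Lemma cisD x y : cis (x + y) = cis x * cis y.
Proof. by rewrite /cis cosD sinD; apply/eqP; rewrite eq_complex; apply/andP; split => /=;
  apply/eqP; ring. Qed.

Lemma cis0 : cis 0 = 1.
Proof. by rewrite /cis cos0 sin0. Qed.

Lemma cisN x : cis (- x) = (cis x)^-1.
Proof.
have E : cis (- x) * cis x = 1 by rewrite -cisD addNr cis0.
have c0 : cis x != 0 by apply: contra_eq_neq E => ->; rewrite mulr0 eq_sym oner_eq0.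
by apply: (mulIf c0); rewrite E mulVf.
Qed.

Lemma cisX x n : cis x ^+ n = cis (n%:R * x).
Proof.
elim: n => [|n IH]; first by rewrite mul0r cis0.
by rewrite exprS IH -cisD mulrSr mulrDl mul1r addrC.
Qed.

Lemma cisXz x (n : int) : cis x ^ n = cis (n%:~R * x).
Proof.
case: n => n; first by rewrite -exprnP cisX.
by rewrite NegzE -invr_expz -exprnP cisX rmorphN mulNr cisN.
Qed.

Lemma cis_pi : cis pi = -1.
Proof. by rewrite /cis cospi sinpi; apply/eqP; rewrite eq_complex; apply/andP; split => /=;
  apply/eqP; ring. Qed.

Lemma cisDN x : cis x + cis (- x) = (2 * cos x)%:C.
Proof.
by rewrite /cis cosN sinN; apply/eqP; rewrite eq_complex; apply/andP; split => /=; apply/eqP;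
  ring.
Qed.

Lemma cis_eq1 t : 0 < t < 2 * pi -> cis t != 1.
Proof.
move=> /andP[t0 t2]; apply/eqP => E.
have : cis (t / 2) ^+ 2 = 1 by rewrite cisX mulrC divfK ?pnatr_eq0.
move/eqP; rewrite sqrf_eq1 /cis !eq_complex /= oppr0 => h.
have : sin (t / 2) = 0 by case/orP: h => /andP[_ /eqP].
apply/eqP; rewrite gt_eqF // sin_gt0_pi // divr_gt0 //= ltr_pdivrMr // mulrC.
exact: t2.
Qed.

Lemma cis_prim_root n : (0 < n)%N -> (2 * n).-primitive_root (cis (pi / n%:R)).
Proof.
move=> n0; have nR : n%:R != 0 :> R by rewrite pnatr_eq0 -lt0n.
have X2n : cis (pi / n%:R) ^+ (2 * n) = 1.
  rewrite mulnC exprM cisX mulrCA divff // mulr1 cis_pi; ring.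
apply/andP; split; first by rewrite muln_gt0.
apply/forallP => -[k /= k2n]; rewrite unity_rootE; apply/eqP.
case: (eqVneq k.+1 (2 * n)%N) => [->|ne]; first by rewrite X2n eqxx.
apply/negbTE; rewrite cisX; apply: cis_eq1.
have kn : (k.+1 < 2 * n)%N by rewrite ltn_neqAle ne.
have n0R : 0 < n%:R :> R by rewrite ltr0n.
rewrite mulr_gt0 ?divr_gt0 ?pi_gt0 ?ltr0n //= mulrA ltr_pdivrMr // mulrAC.
by rewrite ltr_pM2r ?pi_gt0 // -natrM ltr_nat.
Qed.

Lemma cis_half n : (0 < n)%N -> cis (pi / n%:R) ^+ n = -1.
Proof. by move=> n0; rewrite cisX mulrC divfK ?cis_pi // pnatr_eq0 -lt0n. Qed.

(** These sums are 2 cos (pi a / n), and cosine is injective on [0, pi]; hence the traces of the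
    generators determine the pair (a, b). *)
Lemma cis_tr_inj n (a b : nat) : (0 < n)%N -> (a <= n)%N -> (b <= n)%N ->
  cis (pi / n%:R) ^+ a + (cis (pi / n%:R) ^+ a)^-1 =
  cis (pi / n%:R) ^+ b + (cis (pi / n%:R) ^+ b)^-1 -> a = b.
Proof.
move=> n0 an bn; rewrite !cisX -!cisN !cisDN => /eqP.
rewrite eq_complex /= eqxx andbT => /eqP /(mulfI (_ : 2 != 0)) E.
have n0R : 0 < n%:R :> R by rewrite ltr0n.
have I k : (k <= n)%N -> k%:R * (pi / n%:R) \in `[0 : R, pi].
  move=> kn; rewrite in_itv /= mulr_ge0 ?divr_ge0 ?pi_ge0 //= mulrA ler_pdivrMr // mulrC.
  by rewrite ler_pM2l ?pi_gt0 // ler_nat.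
have := cos_inj (I a an) (I b bn) (E _); rewrite pnatr_eq0 => /(_ isT).
move/mulIf; rewrite mulf_neq0 ?invr_eq0 ?gt_eqF ?pi_gt0 // => /(_ isT) /eqP.
by rewrite eqr_nat => /eqP.
Qed.

End Cis.

(** * Traces of the meridian and irreducibility of the normal form *)

Section NumField.
Variable F : numFieldType.

Lemma bezout_exp_eq1 (x : F) (m n : nat) (k l : int) :
  m%:Z * l - n%:Z * k = 1 -> x != 0 -> x ^+ m = 1 -> x ^ k = 1 -> x = 1.
Proof.
move=> mlnk x0 xm xk; rewrite -[x]expr1z -mlnk expfzDr // -exprz_exp -exprnP xm exp1rz.
by rewrite mul1r -invr_expz mulrC -exprz_exp xk exp1rz invr1.
Qed.

(* The traces of the meridian at the reducible pairs, e = 1 and e = 0. *)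
Definition red_trace1 (r s : int) (u v : F) : F := u ^ (- r) * v ^ s + u ^ r * v ^ (- s).
Definition red_trace2 (r s : int) (u v : F) : F := u ^ (- r) * v ^ (- s) + u ^ r * v ^ s.

Lemma tr_diag2 (u : F) : \tr (diag2 u) = u + u^-1.
Proof. by rewrite /mxtrace big_ord2 !mxE. Qed.

Lemma tr_nf2 (v e : F) : \tr (nf2 v e) = v + v^-1.
Proof. by rewrite /mxtrace big_ord2 !mxE /=; ring. Qed.

Lemma tr_diag2_mul_nf2 (r s : int) (u v e : F) : u != 0 -> v != 0 ->
  \tr (diag2 (u ^ (- r)) * nf2 (v ^ s) e) =
  e * (red_trace1 r s u v - red_trace2 r s u v) + red_trace2 r s u v.
Proof.
move=> u0 v0; rewrite /mxtrace big_ord2 mulmx2 !mxE /= /red_trace1 /red_trace2 -!invr_expz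
  invrK; ring.
Qed.

(** The difference factors as - (u^(2r) - 1) (v^(2s) - 1) / (u^r v^s). By Bezout [r] is invertible
    modulo [p] and [s] modulo [q], so neither factor vanishes. *)
Lemma red_trace_sub_neq0 (p q : nat) (r s : int) (u v : F) :
  p%:Z * s - q%:Z * r = 1 -> u != 0 -> v != 0 -> u ^+ p ^+ 2 = 1 -> v ^+ q ^+ 2 = 1 ->
  u ^+ 2 != 1 -> v ^+ 2 != 1 ->
  [/\ (u ^ r) ^+ 2 != 1, (v ^ s) ^+ 2 != 1 & red_trace1 r s u v - red_trace2 r s u v != 0].
Proof.
move=> hrs u0 v0 up vq u1 v1.
have ur : (u ^ r) ^+ 2 != 1.
  apply: contraNneq u1 => ur; apply/eqP.
  apply: (bezout_exp_eq1 hrs); rewrite ?expf_neq0 // 1?exprAC //.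
  by rewrite [u ^+ 2]exprnP exprz_exp mulrC -exprz_exp -exprnP.
have vs : (v ^ s) ^+ 2 != 1.
  apply: contraNneq v1 => vs; apply/eqP.
  apply: (@bezout_exp_eq1 _ q p (- s) (- r)); rewrite ?expf_neq0 // 1?exprAC //; first by lia.
  by rewrite -invr_expz [v ^+ 2]exprnP exprz_exp mulrC -exprz_exp -exprnP vs invr1.
split=> //; rewrite /red_trace1 /red_trace2 -!invr_expz.
move: (u ^ r) (v ^ s) ur vs (expfz_neq0 r u0) (expfz_neq0 s v0) => x y x1 y1 x0 y0.
have -> : x^-1 * y + x * y^-1 - (x^-1 * y^-1 + x * y) = - (x ^+ 2 - 1) * (y ^+ 2 - 1) / (x *
  y).
  by field; rewrite x0 y0.
by rewrite mulf_neq0 ?invr_eq0 ?mulf_neq0 ?oppr_eq0 ?subr_eq0.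
Qed.

Lemma nf2_sign (b : bool) (e : F) : nf2 ((-1) ^+ b) e = diag2 ((-1) ^+ b).
Proof.
case: b; apply: mx2P; rewrite !mxE /= ?expr1 ?expr0 ?invrN1 ?invr1; ring.
Qed.

Lemma diag2_sign_inj (b b' : bool) : diag2 ((-1) ^+ b) = diag2 ((-1) ^+ b') :> 'M[F]_2 -> b =
  b'.
Proof.
move=> /matrixP/(_ 0 0); rewrite !mxE /= => /eqP.
rewrite -subr_eq0; case: b b' => [] [] //; rewrite expr0 expr1.
  by rewrite -opprD oppr_eq0 -[1 + 1]/(2%:R) pnatr_eq0.
by rewrite opprK -[1 + 1]/(2%:R) pnatr_eq0.
Qed.

(** A stable line must be a coordinate axis, as the eigenvalues of alpha are distinct; but both
    off-diagonal entries of beta are nonzero. *)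
Lemma nf2_irreducible (u v e : F) (U : 'M[F]_2) :
  u != 0 -> u ^+ 2 != 1 -> v != 0 -> v ^+ 2 != 1 -> e != 0 -> 1 - e != 0 ->
  stablemx U (diag2 u)^T -> stablemx U (nf2 v e)^T -> \rank U = 0%N \/ \rank U = 2%N.
Proof.
move=> u0 u1 v0 v1 e0 e1 stA stB.
have vv : v - v^-1 != 0.
  by rewrite subr_eq0; apply: contraNneq v1 => E; rewrite expr2 {1}E mulVf.
have uu : u - u^-1 != 0.
  by rewrite subr_eq0; apply: contraNneq u1 => E; rewrite expr2 {1}E mulVf.
have [U0|/rowV0Pn[x xU x0]] := eqVneq U 0; first by left; rewrite U0 mxrank0.
right; apply/eqP; rewrite eqn_leq rank_leq_col /= ltnNge; apply: contraTN stB => r1.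
have Ux : (U <= x)%MS.
  rewrite -(mxrank_leqif_sup xU) rank_rV x0 eqn_leq r1 andbT.
  by have := mxrankS xU; rewrite rank_rV x0.
have st (M : 'M[F]_2) : stablemx U M -> exists k, x *m M = k *: x.
  move=> stM; apply/sub_rVP; apply: submx_trans (submxMr M xU) _.
  by apply: submx_trans stM Ux.
have [k /rowP xA] := st _ stA.
apply/negP => /st[l /rowP xB].
have A0 := xA 0; have A1 := xA 1; have B0 := xB 0; have B1 := xB 1.
move: A0 A1 B0 B1; rewrite !mxE !big_ord2 !mxE /= !mulr0 addr0 add0r.
have xn0 : x 0 0 != 0 \/ x 0 1 != 0.
  case: (eqVneq (x 0 0) 0) => [x00|]; last by left.
  right; apply: contraNneq x0 => x01.
  by apply/eqP/rowP; apply: ord2P; rewrite mxE.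
move: (x 0 0) (x 0 1) xn0 => a b ab A0 A1 B0 B1.
have ab0 : a * b = 0.
  apply: (mulIf uu); rewrite mul0r.
  have -> : a * b * (u - u^-1) = (a * u) * b - a * (b * u^-1) by ring.
  by rewrite A0 A1; ring.
case: ab => [a0|b0].
  have b0 : b = 0 by apply: (mulfI a0); rewrite mulr0.
  move/eqP: B1; rewrite b0 mul0r mulr0 addr0; apply/negP.
  by rewrite !mulf_neq0.
have a0 : a = 0 by apply: (mulIf b0); rewrite mul0r.
move/eqP: B0; rewrite a0 mul0r mulr0 add0r; apply/negP.
by rewrite mulf_neq0.
Qed.

End NumField.

(** * Irreducibility in terms of the generators, Schur's lemma *)

Section Irreducible.
Variable R : realType.
Implicit Types rho : rep R.

(** Stability passes from the generators to all words: by Cayley-Hamilton an inverse is a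
    combination of 1 and the matrix. *)
Lemma irreducible_stable rho (U : 'M[R[i]]_2) : \det rho.1 = 1 -> \det rho.2 = 1 ->
  irreducible_rep rho -> stablemx U rho.1^T -> stablemx U rho.2^T ->
  \rank U = 0%N \/ \rank U = 2%N.
Proof.
move=> dA dB irr stA stB; apply: irr => w.
have st x b : stablemx U (if b then (gen rho x)^-1 else gen rho x)^T.
  have stx : stablemx U (gen rho x)^T by rewrite /gen; case: ifP.
  case: b => //; rewrite mx2_inv_tr; last by rewrite /gen; case: ifP.
  by rewrite linearB /= tr_scalar_mx stablemxD ?stablemxN ?stablemxC.
elim: w => [|[x b] w IH].
  by rewrite /ev big_nil trmx1 mulmx1.
by rewrite /ev big_cons -mulmxE trmx_mul; apply: stablemxM; [exact: IH|exact: (st x b)].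
Qed.

Lemma irreducible_conj rho rho' : conj_rep rho rho' -> \det rho.1 = 1 -> \det rho.2 = 1 ->
  irreducible_rep rho -> irreducible_rep rho'.
Proof.
case=> S dS -> dA dB irr U stU; have Su := unit_det1 dS.
have Sm : S \in unitmx by [].
have rU : \rank (U *m invmx S^T) = \rank U.
  by rewrite mxrankMfree // row_free_unit unitmx_inv unitmx_tr.
have st (M : 'M[R[i]]_2) : stablemx U (S * M * S^-1)^T -> stablemx (U *m invmx S^T) M^T.
  rewrite -[S^-1]/(invmx S) -!mulmxE !trmx_mul trmx_inv => stM.
  have := submxMr (invmx S^T) stM.
  by rewrite !mulmxA mulmxK ?unitmx_tr.
rewrite -rU; apply: (irreducible_stable dA dB irr); apply: st.
  by have := stU [:: (alpha, false)]; rewrite /ev big_seq1.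
by have := stU [:: (beta, false)]; rewrite /ev big_seq1.
Qed.

(** Schur's lemma: an eigenspace of [Z] is stable and nonzero, hence the whole space. *)
Lemma irreducible_comm_scalar rho (Z : 'M[R[i]]_2) : \det rho.1 = 1 -> \det rho.2 = 1 ->
  irreducible_rep rho -> Z * rho.1 = rho.1 * Z -> Z * rho.2 = rho.2 * Z ->
  exists c, Z = c%:M.
Proof.
move=> dA dB irr ZA ZB.
have [c cP] := @eigenvalue_closed _ _ Z^T isT.
have st (M : 'M[R[i]]_2) : Z * M = M * Z -> stablemx (eigenspace Z^T c) M^T.
  move=> ZM; apply: comm_mx_stable_eigenspace; rewrite /comm_mx -!trmx_mul.
  by rewrite !mulmxE ZM.
have [r0|r2] := irreducible_stable dA dB irr (st _ ZA) (st _ ZB).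
  by move: cP; rewrite /eigenvalue -mxrank_eq0 r0.
by exists c; rewrite -[Z]trmxK (rank2_eigenspace r2) tr_scalar_mx.
Qed.

(** If one generator were scalar, the other would commute with both and be scalar as well; then
    every line would be stable. *)
Lemma irreducible_not_scalar rho c : \det rho.1 = 1 -> \det rho.2 = 1 ->
  irreducible_rep rho -> rho.1 != c%:M /\ rho.2 != c%:M.
Proof.
move=> dA dB irr.
have sc (k : R[i]) (M : 'M[R[i]]_2) : k%:M * M = M * k%:M by rewrite -!mulmxE scalar_mxC.
have nsc k l : rho.1 = k%:M -> rho.2 = l%:M -> False.
  move=> A B; pose U : 'M[R[i]]_2 := delta_mx 0 0.
  have := @irreducible_stable rho U dA dB irr.
  rewrite A B !tr_scalar_mx => /(_ (stablemxC _ _) (stablemxC _ _)).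
  by rewrite mxrank_delta => -[].
split; apply/eqP => E.
  have [|l B] := @irreducible_comm_scalar rho rho.2 dA dB irr _ erefl; last exact: nsc E B.
  by rewrite E sc.
have [|l A] := @irreducible_comm_scalar rho rho.1 dA dB irr erefl; last exact: nsc A E.
by rewrite E sc.
Qed.

Lemma irreducible_entry01 rho u : \det rho.1 = 1 -> \det rho.2 = 1 ->
  irreducible_rep rho -> rho.1 = diag2 u -> rho.2 0 1 != 0.
Proof.
move=> dA dB irr A; apply/eqP => y0; pose U : 'M[R[i]]_2 := delta_mx 1 1.
have st (M : 'M[R[i]]_2) : M 0 1 = 0 -> stablemx U M^T.
  move=> M01; rewrite (_ : U *m M^T = M 1 1 *: U) ?scalemx_sub //.
  by apply: mx2P; rewrite !mxE big_ord2 !mxE /= ?M01; ring.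
have := @irreducible_stable rho U dA dB irr.
rewrite {1}A => /(_ (st _ _) (st _ y0)); rewrite mxE /= => /(_ erefl).
by rewrite mxrank_delta => -[].
Qed.

End Irreducible.

Section Conjugates.
Variable F : comUnitRingType.

Lemma conjX (S M : 'M[F]_2) (n : nat) : S \is a GRing.unit ->
  (S * M * S^-1) ^+ n = S * M ^+ n * S^-1.
Proof.
move=> Su; elim: n => [|k IH]; first by rewrite !expr0 mulr1 divrr.
by rewrite !exprS IH !mulrA mulrVK.
Qed.

Lemma mxtrace_conj (S M : 'M[F]_2) : S \is a GRing.unit -> \tr (S * M * S^-1) = \tr M.
Proof. by move=> Su; rewrite -mulmxE mxtrace_mulC mulmxE mulrA mulVr // mul1r. Qed.

End Conjugates.

(** * Reduction of an irreducible representation to the normal form *)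

Section NormalForm.
Variable R : realType.
Implicit Types rho : rep R.

(** By Schur's lemma alpha^p = beta^q is a scalar of square 1, so the orders of the generators
    divide 2p and 2q. Alpha is diagonalised first; a diagonal conjugation, which leaves alpha
    unchanged, then normalises beta. *)
Lemma irreducible_normal_form (p q : nat) rho : (0 < p)%N -> (0 < q)%N ->
  is_rep p q rho -> irreducible_rep rho ->
  exists (a b : nat) (e : R[i]), [/\ (0 < a < p)%N, (0 < b < q)%N, odd a = odd b &
    conj_rep rho (diag2 (cis (pi / p%:R) ^+ a), nf2 (cis (pi / q%:R) ^+ b) e)].
Proof.
move=> p0 q0 [dA dB AB] irr.
have [k Zk] : exists k, rho.1 ^+ p = k%:M.
  apply: (irreducible_comm_scalar dA dB irr); first by rewrite -exprSr exprS.
  by rewrite AB -exprSr exprS.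
have k2 : k ^+ 2 = 1.
  have <- : \det (k%:M : 'M[R[i]]_2) = k ^+ 2 by rewrite det_scalar.
  rewrite -Zk; elim: (p) => [|n IH]; first by rewrite expr0 det1.
  by rewrite exprS -mulmxE det_mulmx dA mul1r.
have kk : (k%:M : 'M[R[i]]_2) ^+ 2 = 1.
  by rewrite expr2 -mulmxE -scalar_mxM -expr2 k2.
have A2p : rho.1 ^+ (2 * p) = 1 by rewrite mulnC exprM Zk kk.
have [S [a [ap dS SA]]] := diag2_conj_half (cis_prim_root R p0) (cis_half R p0) A2p dA
  (fun c => (irreducible_not_scalar c dA dB irr).1).
have Su := unit_det1 dS.
pose rho1 : rep R := (S * rho.1 * S^-1, S * rho.2 * S^-1).
have c1 : conj_rep rho rho1 by exists S.
have dA1 : \det rho1.1 = 1 by rewrite /= det_conj.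
have dB1 : \det rho1.2 = 1 by rewrite /= det_conj.
have irr1 := irreducible_conj c1 dA dB irr.
have B2q : rho1.2 ^+ (2 * q) = 1.
  by rewrite /= conjX // mulnC exprM -AB Zk kk mulr1 divrr.
have [S' [b [bq dS' SB]]] := diag2_conj_half (cis_prim_root R q0) (cis_half R q0) B2q dB1
  (fun c => (irreducible_not_scalar c dA1 dB1 irr1).2).
have Su' := unit_det1 dS'.
set u := _ ^+ a in SA *; set v := _ ^+ b in SB *.
have zq0 := prim_root_neq0 (cis_prim_root R q0).
have v0 : v != 0 by rewrite expf_neq0.
have zp0 := prim_root_neq0 (cis_prim_root R p0).
have u0 : u != 0 by rewrite expf_neq0.
have v1 : v ^+ 2 != 1.
  rewrite -exprM mulnC; apply: (prim_root_exp_neq1 (cis_prim_root R q0)).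
  by move: bq => /andP[b0 bq]; lia.
(* Diagonalising beta serves only to find its trace: conjugating by [S'] need not keep alpha
   diagonal. *)
have trB : \tr rho1.2 = v + v^-1.
  by rewrite -(mxtrace_conj rho1.2 Su') SB /mxtrace big_ord2 !mxE.
have y0 := irreducible_entry01 dA1 dB1 irr1 SA.
have [t [e [t0 tB]]] := nf2_conj v0 v1 dB1 trB y0.
have c2 : conj_rep rho1 (diag2 u, nf2 v e).
  have tu : diag2 t \is a GRing.unit by exact/unit_det1/diag2_det.
  have tA : diag2 t * rho1.1 * (diag2 t)^-1 = diag2 u.
    by rewrite (_ : rho1.1 = diag2 u) // diag2M mulrC -diag2M mulrK.
  by exists (diag2 t); [exact: diag2_det|rewrite tA tB].
exists a, b, e; split => //; last exact: conj_rep_trans c1 c2.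
(* In the normal form alpha^p and beta^q are the scalars (-1)^a and (-1)^b, so the relation forces
   equal parities. *)
have [S2 dS2 [EA EB]] := conj_rep_trans c1 c2.
have S2u := unit_det1 dS2.
have Ep : diag2 u ^+ p = S2 * rho.1 ^+ p * S2^-1 by rewrite EA conjX.
have Eq : nf2 v e ^+ q = S2 * rho.2 ^+ q * S2^-1 by rewrite EB conjX.
have : diag2 u ^+ p = nf2 v e ^+ q by rewrite Ep Eq AB.
rewrite !exprnP diag2X // nf2X // -!exprnP /u /v.
rewrite [in diag2 _]exprAC [in nf2 _ _]exprAC !cis_half //.
rewrite -[(-1) ^+ a]signr_odd -[(-1) ^+ b]signr_odd nf2_sign.
exact: diag2_sign_inj.
Qed.

End NormalForm.

(** * Level sets of the trace of the meridian *)

Local Open Scope classical_set_scope.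

Section Level.
Variables (R : realType) (p q : nat) (r s : int) (c : R[i]).
Hypotheses (p0 : (0 < p)%N) (q0 : (0 < q)%N)
  (hrs : p%:Z * s - q%:Z * r = 1) (hc : generic p q r s c).

Let u (a : nat) : R[i] := cis (pi / p%:R) ^+ a.
Let v (b : nat) : R[i] := cis (pi / q%:R) ^+ b.
(** The solution of the affine equation saying that the meridian has trace [c]. *)
Let e (a b : nat) : R[i] :=
  (c - red_trace2 r s (u a) (v b)) / (red_trace1 r s (u a) (v b) - red_trace2 r s (u a) (v b)).

Definition level_rep (ab : nat * nat) : rep R :=
  (diag2 (u ab.1), nf2 (v ab.2) (e ab.1 ab.2)).

Definition level_index : seq (nat * nat) :=
  [seq (a, b) | a <- index_iota 1 p, b <- [seq b <- index_iota 1 q | odd b == odd a]].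

Lemma level_indexP a b :
  reflect [/\ (0 < a < p)%N, (0 < b < q)%N & odd a = odd b] ((a, b) \in level_index).
Proof.
apply: (iffP allpairsPdep) => [[a' [b' [a1 b1 [-> ->]]]]|[a1 b1 ab]].
  by move: a1 b1; rewrite mem_filter !mem_index_iota => -> /andP[/eqP ->].
by exists a, b; rewrite mem_filter !mem_index_iota a1 b1 ab eqxx.
Qed.

Lemma u_neq0 a : u a != 0.
Proof. by rewrite expf_neq0 // (prim_root_neq0 (cis_prim_root R p0)). Qed.

Lemma v_neq0 b : v b != 0.
Proof. by rewrite expf_neq0 // (prim_root_neq0 (cis_prim_root R q0)). Qed.

Lemma cis_exp_half n a : (0 < n)%N -> cis (pi / n%:R : R) ^+ a ^+ n = (-1) ^+ odd a.
Proof. by move=> n0; rewrite exprAC cis_half // signr_odd. Qed.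

Lemma cis_exp_sqr n a : (0 < n)%N -> cis (pi / n%:R : R) ^+ a ^+ n ^+ 2 = 1.
Proof. by move=> n0; rewrite cis_exp_half // sqrr_sign. Qed.

Lemma cis_exp_sqr_neq1 n a : (0 < a < n)%N -> cis (pi / n%:R : R) ^+ a ^+ 2 != 1.
Proof.
move=> /andP[a0 an]; have n0 := leq_ltn_trans (leq0n a) an.
rewrite -exprM mulnC; apply: (prim_root_exp_neq1 (cis_prim_root R n0)).
by lia.
Qed.

Lemma red_trace1E a b : red_trace1 r s (u a) (v b) =
  (2 * cos (a%:R * r%:~R * pi / p%:R - b%:R * s%:~R * pi / q%:R))%:C.
Proof.
rewrite -cisDN /red_trace1 /u /v !cisX !cisXz -!cisD addrC.
by congr (cis _ + cis _); rewrite ?rmorphN; ring.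
Qed.

Lemma red_trace2E a b : red_trace2 r s (u a) (v b) =
  (2 * cos (a%:R * r%:~R * pi / p%:R + b%:R * s%:~R * pi / q%:R))%:C.
Proof.
rewrite -cisDN /red_trace2 /u /v !cisX !cisXz -!cisD addrC.
by congr (cis _ + cis _); rewrite ?rmorphN; ring.
Qed.

Lemma tr_nf_meridian (x y t : R[i]) : x != 0 -> y != 0 ->
  \tr (ev (diag2 x, nf2 y t) (meridian r s)) =
  t * (red_trace1 r s x y - red_trace2 r s x y) + red_trace2 r s x y.
Proof.
move=> x0 y0; rewrite -tr_diag2_mul_nf2 // ev_word_eval /meridian word_eval_cat
  !word_eval_wpow.
by rewrite -diag2X // -nf2X.
Qed.

Section Index.
Variables a b : nat.
Hypothesis ab : (a, b) \in level_index.

Lemma level_facts : [/\ u a ^+ 2 != 1, v b ^+ 2 != 1,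
  (u a ^ r) ^+ 2 != 1, (v b ^ s) ^+ 2 != 1 &
  red_trace1 r s (u a) (v b) - red_trace2 r s (u a) (v b) != 0].
Proof.
have [ap bq _] := level_indexP _ _ ab.
have u1 := cis_exp_sqr_neq1 ap; have v1 := cis_exp_sqr_neq1 bq.
have up := cis_exp_sqr a p0; have vq := cis_exp_sqr b q0.
by have [ur vs ct] := red_trace_sub_neq0 hrs (u_neq0 a) (v_neq0 b) up vq u1 v1.
Qed.

(** The values 0 and 1 of the parameter correspond to the two reducible traces, which genericity
    excludes. *)
Lemma level_e : e a b != 0 /\ 1 - e a b != 0.
Proof.
have [ap bq oab] := level_indexP _ _ ab; have [_ _ _ _ ct] := level_facts.
have [g1 g2] := hc ap bq oab.
have E2 : c - red_trace2 r s (u a) (v b) != 0 by rewrite subr_eq0 red_trace2E; apply/eqP.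
have E1 : c - red_trace1 r s (u a) (v b) != 0 by rewrite subr_eq0 red_trace1E; apply/eqP.
split; first by rewrite mulf_neq0 ?invr_eq0.
have -> : 1 - e a b = - (c - red_trace1 r s (u a) (v b)) / (red_trace1 r s (u a) (v b) -
  red_trace2 r s (u a) (v b)).
  by apply: (mulIf ct); rewrite mulrBl mul1r /e !divfK //; ring.
by rewrite mulf_neq0 ?invr_eq0 ?oppr_eq0.
Qed.

Lemma level_rep_in : tr_level p q r s c (conj_class (level_rep (a, b))).
Proof.
have [ap bq oab] := level_indexP _ _ ab; have [u1 v1 _ _ ct] := level_facts.
have [e0 e1] := level_e; have u0 := u_neq0 a; have v0 := v_neq0 b.
exists (level_rep (a, b)); split => //.
- split; [exact: diag2_det|exact: nf2_det|].
  rewrite /level_rep /= !exprnP diag2X // nf2X // -!exprnP !cis_exp_half //.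
  by rewrite oab nf2_sign.
- move=> U stU; apply: (nf2_irreducible u0 u1 v0 v1 e0 e1).
    by have := stU [:: (alpha, false)]; rewrite /ev big_seq1.
  by have := stU [:: (beta, false)]; rewrite /ev big_seq1.
- by rewrite tr_nf_meridian // divfK // subrK.
Qed.

Lemma level_torsion :
  adjoint_torsion p q r s (conj_class (level_rep (a, b))) =
  p%:R * q%:R / (chord (u a ^+ 2) * chord (v b ^+ 2)).
Proof.
have [u1 v1 ur vs ct] := level_facts; have [e0 e1] := level_e.
have u0 := u_neq0 a; have v0 := v_neq0 b.
apply: (adjoint_torsion_conj_class hrs); [exact: diag2_det|exact: nf2_det|].
move=> T; apply: (nf_adjoint_torsionP hrs) => //; exact: cis_exp_sqr.
Qed.

End Index.

(** Every class in the level set has a normal form with some parameter [t]; the trace of the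
    meridian is affine in [t] with nonzero slope, so the value [c] forces [t = e a b]. *)
Lemma tr_levelE :
  tr_level p q r s c = [set conj_class (level_rep ab) | ab in [set` level_index]].
Proof.
apply/seteqP; split=> [X [rho [rhoP irr trc ->]]|_ [[a b] ab <-]]; last exact: level_rep_in.
have [a [b [t [ap bq oab cj]]]] := irreducible_normal_form p0 q0 rhoP irr.
have ab : (a, b) \in level_index by apply/level_indexP.
exists (a, b) => //; rewrite (conj_class_eq cj).
suff -> : t = e a b by [].
have [_ _ _ _ ct] := level_facts ab; have [dA dB _] := rhoP.
have trE := tr_nf_meridian t (u_neq0 a) (v_neq0 b).
have trc' : \tr (ev (diag2 (u a), nf2 (v b) t) (meridian r s)) = c.
  by case: cj => S dS ->; rewrite ev_conj // mxtrace_conj ?unit_det1.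
by apply: (mulIf ct); rewrite /e divfK // -trc' trE addrK.
Qed.

Lemma level_rep_inj : set_inj [set` level_index] (fun ab => conj_class (level_rep ab)).
Proof.
move=> [a b] [a' b'] /set_mem /= ab /set_mem /= ab' E.
have [] : conj_rep (level_rep (a, b)) (level_rep (a', b')).
  have : conj_class (level_rep (a', b')) (level_rep (a', b')) by exact: conj_rep_refl.
  by rewrite -E.
move=> S dS [EA EB]; have Su := unit_det1 dS.
have [/andP[_ ap] /andP[_ bq] _] := level_indexP _ _ ab.
have [/andP[_ ap'] /andP[_ bq'] _] := level_indexP _ _ ab'.
have tA : \tr (diag2 (u a)) = \tr (diag2 (u a')) by rewrite EA mxtrace_conj.
have tB : \tr (nf2 (v b) (e a b)) = \tr (nf2 (v b') (e a' b')) by rewrite EB mxtrace_conj.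
rewrite tr_diag2 tr_diag2 in tA; rewrite tr_nf2 tr_nf2 in tB.
have -> := cis_tr_inj p0 (ltnW ap) (ltnW ap') tA.
by have -> := cis_tr_inj q0 (ltnW bq) (ltnW bq') tB.
Qed.

End Level.

Theorem theorem5p5 (R : realType) (p q : nat) (r s : int) (c : R[i]) (g : nat)
    (hp : (0 < p)%N) (hq : (0 < q)%N) (hpq : coprime p q) (q_odd : odd q)
    (hrs : p%:Z * s - q%:Z * r = 1) (hc : generic p q r s c) :
  finite_set (tr_level p q r s c) /\
  exists n : int,
    \sum_(X \in tr_level p q r s c)
      (2 * adjoint_torsion p q r s X) ^ (g%:Z - 1) = n%:~R.
Proof.
rewrite tr_levelE //; split; first exact/finite_image/finite_seq.
rewrite fsbig_image; last exact: level_rep_inj.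
have uI : uniq (level_index p q).
  apply: allpairs_uniq_dep => [|a _|[a b] [a' b'] _ _ [-> ->] //]; first exact: iota_uniq.
  by rewrite filter_uniq // iota_uniq.
rewrite -fsbig_seq // big_seq.
(* The chords are taken at u^2 and v^2, that is at powers of the squares of the 2n-th roots for n =
   p and n = q. *)
have prim n : (0 < n)%N -> n.-primitive_root (cis (pi / n%:R : R) ^+ 2).
  move=> n0; have := exp_prim_root (cis_prim_root R n0) 2.
  by rewrite (gcdn_idPl _) ?dvdn_mulr // mulKn.
have [n nE] := integral_verlinde_sum g q_odd (prim p hp) (prim q hq).
exists n; rewrite -nE.
transitivity (\sum_(ab <- level_index p q | ab \in level_index p q)
    (2 * (p%:R * q%:R / (chord ((cis (pi / p%:R : R) ^+ 2) ^+ ab.1) *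
                         chord ((cis (pi / q%:R : R) ^+ 2) ^+ ab.2)))) ^ (g%:Z - 1)).
  apply: eq_bigr => -[a b] ab; rewrite (level_torsion hp hq hrs hc ab).
  by rewrite (exprAC _ 2) (exprAC _ 2).
by rewrite -big_seq big_allpairs_dep; apply: eq_bigr => a _; rewrite big_filter.
Qed.
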